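(* Assume (A2), (A3), $\rho<0$, and that the tail-index satisfies $\alpha>1$. Let $\nu_k$ and $\nu_\infty$ denote the laws of $x_k$ and of the stationary solution $x_\infty$, and let $1\le p<\alpha$ with $\nu_0$ having finite $p$-th moment. Then $h(p)^{1/p}\in(0,1)$ and for all $k\ge0$ $$\mathcal{W}_p(\nu_k,\nu_\infty)\le (h(p))^{k/p}\,\mathcal{W}_p(\nu_0,\nu_\infty).$$
   Context: Setup: integers $d,b\ge1$, stepsize $\eta>0$, i.i.d. data $(a_i,y_i)$; $H_k=\sum_{i=b(k-1)+1}^{bk}a_ia_i^T$, $M_k=I_d-\frac{\eta}{b}H_k$, $q_k=\frac{\eta}{b}\sum_{i=b(k-1)+1}^{bk}a_iy_i$, $x_k=M_kx_{k-1}+q_k$ with $x_0$ independent of the data. $\|\cdot\|$ Euclidean/spectral norm. $\Pi_k=M_k\cdots M_1$, $h(s)=\lim_{k\to\infty}(\mathbb{E}\|\Pi_k\|^s)^{1/k}$, $\rho=\lim_{k\to\infty}(2k)^{-1}\log\lambda_{\max}(\Pi_k^T\Pi_k)$. Tail-index $\alpha$: unique $\alpha>0$ with $h(\alpha)=1$. $\mathcal{W}_p(\nu_1,\nu_2)=(\inf\mathbb{E}\|Z_1-Z_2\|^p)^{1/p}$, infimum over couplings of $\nu_1,\nu_2$ (probability measures on $\mathbb{R}^d$ with finite $p$-th moment). Assumptions: (A2) $y_i$ i.i.d. with continuous density supported on $\mathbb{R}$, all moments finite. (A3) $a_i\sim\mathcal{N}(0,\sigma^2I_d)$ i.i.d.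 *)

(* Defs.v *)
From HB Require Import structures.
From mathcomp Require Import all_boot all_order all_algebra.
From mathcomp Require Import all_classical all_reals all_analysis.
Unset Printing Implicit Defensive.
Import Order.TTheory GRing.Theory Num.Theory.
Import numFieldNormedType.Exports.
Local Open Scope classical_set_scope.
Local Open Scope ring_scope.

(* Vectors of R^d are column vectors 'cV[R]_d.  The sigma-algebra on R^d is the
   Borel sigma-algebra, i.e. (d finite) the one generated by the boxes
   B_1 x ... x B_d with each B_j a Borel subset of R. *)
Definition boxes (R : realType) (d : nat) : set (set 'cV[R]_d) :=
  [set A | exists B : 'I_d -> set R,
      (forall j, measurable (B j)) /\ A = [set v : 'cV[R]_d | forall j, B j (v j ord0)]].

Definition vecm (R : realType) (d : nat) := g_sigma_algebraType (boxes R d).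

Definition enorm (R : realType) (d : nat) (v : 'cV[R]_d) : R :=
  Num.sqrt (\sum_(j < d) (v j ord0) ^+ 2).

Definition opnorm (R : realType) (d : nat) (A : 'M[R]_d) : R :=
  sup [set enorm R d (A *m v) | v in [set v : 'cV[R]_d | enorm R d v <= 1]].

Definition lambda_max (R : realType) (d : nat) (A : 'M[R]_d) : R :=
  sup [set r : R | eigenvalue A r].

Definition preimg_class (dT dV : measure_display) (T : measurableType dT)
    (V : measurableType dV) (X : T -> V) : set (set T) :=
  [set A | exists2 B : set V, measurable B & A = X @^-1` B].

Definition mutual_indep (dT : measure_display) (T : measurableType dT)
    (R : realType) (P : probability T R) (I : eqType) (F : I -> set (set T)) :=
  forall (J : seq I) (A : I -> set T), uniq J ->
    (forall i, i \in J -> F i (A i)) ->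
    P (\big[setI/setT]_(i <- J) A i) = (\prod_(i <- J) P (A i))%E.

Section SGD.
Variables (R : realType) (dT : measure_display) (T : measurableType dT).
Variables (d b : nat) (eta : R) (a : nat -> T -> 'cV[R]_d) (y : nat -> T -> R).

(* Samples are indexed from 0: batch k (k >= 1) uses samples
   b(k-1), ..., bk-1 (i.e. b(k-1)+1, ..., bk in the paper's 1-based indexing). *)
Definition Hk (k : nat) (w : T) : 'M[R]_d :=
  \sum_(b * k.-1 <= i < b * k) (a i w *m (a i w)^T).
Definition Mk (k : nat) (w : T) : 'M[R]_d :=
  1%:M - (eta / b%:R) *: Hk k w.
Definition qk (k : nat) (w : T) : 'cV[R]_d :=
  (eta / b%:R) *: \sum_(b * k.-1 <= i < b * k) (y i w *: a i w).

Fixpoint Pik (k : nat) (w : T) : 'M[R]_d :=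
  match k with 0 => 1%:M | k'.+1 => Mk k w *m Pik k' w end.

Fixpoint xk (x0 : T -> 'cV[R]_d) (k : nat) (w : T) : 'cV[R]_d :=
  match k with 0 => x0 w | k'.+1 => Mk k w *m xk x0 k' w + qk k w end.
End SGD.

Definition law (R : realType) (dT : measure_display) (T : measurableType dT)
    (P : probability T R) (d : nat) (X : T -> 'cV[R]_d) : set (vecm R d) -> \bar R :=
  pushforward P (X : T -> vecm R d).

Definition couplings (R : realType) (d : nat) (nu1 nu2 : set (vecm R d) -> \bar R)
  : set (probability (vecm R d * vecm R d)%type R) :=
  [set Q | forall A : set (vecm R d), measurable A ->
       Q (A `*` setT) = nu1 A /\ Q (setT `*` A) = nu2 A].

(* W_p, valued in \bar R (= +oo when no coupling has finite p-th moment) *)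
Definition Wass (R : realType) (d : nat) (p : R) (nu1 nu2 : set (vecm R d) -> \bar R)
  : \bar R :=
  ((ereal_inf [set (\int[Q]_z ((enorm R d (z.1 - z.2 : 'cV[R]_d)) `^ p)%:E)%E
               | Q in couplings R d nu1 nu2]) `^ p^-1)%E.

(* Main.v *)
Require Import Defs.
From HB Require Import structures.
From mathcomp Require Import all_boot all_order all_algebra.
From mathcomp Require Import all_classical all_reals all_analysis.
From mathcomp Require Import measurable_realfun ring lra.
Import Order.TTheory GRing.Theory Num.Theory.
Import numFieldNormedType.Exports.
Local Open Scope classical_set_scope.
Local Open Scope ring_scope.
Set Implicit Arguments.
Unset Strict Implicit.

(* Because the law of [a_i] is invariant under rotations, [E ||M_1 z||^s] depends
   on [z] only through its norm, so that [E ||M_1 z||^s = m(s) ||z||^s] for every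
   fixed [z].  By independence of the batches, [E ||Pi_k z||^s = m(s)^k ||z||^s];
   as [||Pi_k||] is comparable to the sum of the norms of the columns of [Pi_k],
   this gives [h(s) = m(s)].  Weighted AM-GM and [m(alpha) = 1] yield
   [m(p) <= 1], and uniqueness of the tail-index excludes equality.  Finally,
   driving both components of a coupling of [nu_k] and [nu_infty] by the same
   fresh batch produces a coupling of [nu_(k+1)] and [nu_infty], and multiplies
   the transport cost by exactly [m(p)]. *)

(** * Independence and product measures *)

(** Givens rotations with nonnegative cosine already carry every vector onto a multiple of a fixed
    basis vector, and each of them is a product of three planar shears, whose invariance comes from
    that of Lebesgue measure under translations. A batch uses one state for [b] samples, so it is
    not a composition of maps of the state alone; independence and rotation invariance are carried
    through it sample by sample on pairs (state, partial sum). Positivity of [h(p)] also rests on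
    the tail-index: if [h(p) = 0], then [M_1 z = 0] almost surely for a unit vector [z], hence
    [h(alpha) = 0] instead of 1. The new coupling lives on the product of the old coupling with the
    sample space, which makes the batch independent of both points; stationarity enters only as a
    property of the law. The contraction holds coupling by coupling for [p]-th powers, so no optimal
    coupling has to exist, infinite costs are allowed, and the [p]-th root is taken at the very
    end. *)

Section general_measure.
Local Open Scope ereal_scope.
Context (R : realType).

(* Without measurability, since [opnorm R d (Pik ...)] is not shown to be measurable. *)
Lemma ge0_le_integral_nomeas d (T : measurableType d)
    (mu : {measure set T -> \bar R}) (f g : T -> \bar R) :
  (forall x, 0 <= f x) -> (forall x, f x <= g x) ->
  \int[mu]_x f x <= \int[mu]_x g x.
Proof.
move=> f0 fg.
have g0 x : 0 <= g x := le_trans (f0 x) (fg x).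
rewrite !ge0_integralTE//.
apply: ereal_sup_le => /= _ [h hf <-]; exists h => // x.
exact: le_trans (hf x) (fg x).
Qed.

(** Rectangles form a generating pi-system, so the law of [(X, Y)] restricted to [E] coincides with
    [m1 \x m2] scaled by [P E]. The event [E] is there to carry further independent coordinates or
    later samples along. *)
Lemma indep_pair_product d d1 d2 (T : measurableType d) (V : measurableType d1)
    (W : measurableType d2) (P : probability T R) (E : set T)
    (X : T -> V) (Y : T -> W) (m1 : {sigma_finite_measure set V -> \bar R})
    (m2 : {sigma_finite_measure set W -> \bar R}) :
  measurable E -> measurable_fun setT X -> measurable_fun setT Y ->
  (forall A B, measurable A -> measurable B ->
    P (E `&` (X @^-1` A `&` Y @^-1` B)) = P E * (m1 A * m2 B)) ->
  forall C : set (V * W), measurable C ->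
    P (E `&` (fun w => (X w, Y w)) @^-1` C) =
    P E * (m1 \x m2) C.
Proof.
move=> mE mX mY indep C mC.
have mXY : measurable_fun setT (fun w => (X w, Y w)).
  exact: measurable_fun_pair.
have c0 : (0 <= fine (P E))%R by rewrite fine_ge0.
pose c := NngNum c0.
have PEc : P E = c%:num%:E by rewrite /= fineK ?fin_num_measure.
pose mE' : {measure set T -> \bar R} := mrestr P mE.
pose m'0 : {measure set (V * W) -> \bar R} := pushforward mE' (fun w => (X w, Y w)).
pose m' := m'0 mXY.
pose m12 : {measure set (V * W) -> \bar R} := mscale c (m1 \x m2).
have -> : P (E `&` (fun w => (X w, Y w)) @^-1` C) = m' C.
  by rewrite /m' /mE' /= /pushforward /mrestr setIC.
rewrite PEc -[RHS]/(m12 C).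
pose G : set (set (V * W)) :=
  [set D | exists A, measurable A /\ exists B, measurable B /\ D = A `*` B].
apply: (@measure_unique _ _ _ G (fun=> setT)) => //.
- rewrite measurable_prod_measurableType //; congr (<<s _ >>).
  rewrite predeqE; split => [[A mA [B mB <-]]|[A [mA [B [mB ->]]]]].
    by exists A; split => //; exists B.
  by exists A => //; exists B.
- move=> /= _ _ [X1 [mX1 [X2 [mX2 ->]]]] [Y1 [mY1 [Y2 [mY2 ->]]]].
  rewrite -setXI; exists (X1 `&` Y1); split; first exact: measurableI.
  by exists (X2 `&` Y2); split => //; exact: measurableI.
- by move=> _; exists setT; split => //; exists setT; split => //; rewrite setXTT.
- by rewrite bigcup_const.
- move=> D [A [mA [B [mB ->]]]].
  rewrite -[RHS]/(c%:num%:E * (m1 \x m2) (A `*` B)) product_measure1E// -PEc.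
  by rewrite /m' /= /pushforward /mrestr setIC -indep.
- move=> _; rewrite /m' /mE' /=; rewrite /pushforward /mrestr.
  apply: (@le_lt_trans _ _ 1); last by rewrite ltry.
  apply: probability_le1; apply: measurableI => //.
  by rewrite preimage_setT.
Qed.

(** The joint law is the product of the marginal laws, so Tonelli's theorem freezes [X] while [Y] is
    averaged over an independent copy. *)
Lemma indep_integral d d1 d2 (T : measurableType d) (V : measurableType d1)
    (W : measurableType d2) (P : probability T R)
    (X : T -> V) (Y : T -> W) (f : V * W -> \bar R) :
  measurable_fun setT X -> measurable_fun setT Y ->
  (forall A B, measurable A -> measurable B ->
    P (X @^-1` A `&` Y @^-1` B) = P (X @^-1` A) * P (Y @^-1` B)) ->
  measurable_fun [set: (V * W)%type] f -> (forall z, 0 <= f z) ->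
  \int[P]_w f (X w, Y w) = \int[P]_w (\int[P]_w' f (X w, Y w')).
Proof.
move=> mX mY indep mf f0.
have mXY : measurable_fun setT (fun w => (X w, Y w)).
  exact: measurable_fun_pair.
pose DX : {sigma_finite_measure set V -> \bar R} :=
  distribution P (mfun_Sub (mem_set mX)).
pose DY : {sigma_finite_measure set W -> \bar R} :=
  distribution P (mfun_Sub (mem_set mY)).
have mFf : measurable_fun setT (fubini_F DY f).
  exact: measurable_fun_fubini_tonelli_F.
transitivity (\int[pushforward P (fun w => (X w, Y w))]_z f z).
  by rewrite ge0_integral_pushforward.
transitivity (\int[DX \x DY]_z f z).
  apply: eq_measure_integral => C mC _.
  have := @indep_pair_product _ _ _ _ _ _ P setT X Y DX DY measurableT mX mY _ C mC.
  rewrite setTI probability_setT mul1e; apply.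
  by move=> A B mA mB; rewrite setTI mul1e indep.
rewrite fubini_tonelli1// ge0_integral_pushforward//=.
  apply: eq_integral => w _ /=.
  rewrite /fubini_F ge0_integral_pushforward//=.
  exact: measurable_fun_pair2.
by move=> v _; exact: integral_ge0.
Qed.

End general_measure.

(** * Rotation invariance of the planar Gaussian measure *)

Section gaussian_plane.
Local Open Scope ereal_scope.
Context (R : realType).
Local Notation mu := (@lebesgue_measure R).
Local Notation mu2 := (mu \x mu).
Implicit Types f : R * R -> \bar R.

Lemma lebesgue_measure_shift (c : R) (A : set R) : measurable A ->
  pushforward mu (fun x : measurableTypeR R => (x + c)%R : measurableTypeR R) A = mu A.
Proof.
move=> mA; apply/esym/lebesgue_measure_unique => //=.
  exact: measurable_funD.
move=> mc _ [[a b]] _ <-.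
rewrite /pushforward/=.
have -> : (fun x : R => (x + c)%R) @^-1` `]a, b] = `](a - c)%R, (b - c)%R]%classic.
  by apply/seteqP; split => x /=; rewrite !in_itv/= ltrBlDr lerBrDr.
by rewrite !lebesgue_measure_itv/= !lte_fin ltrD2r -!EFinB opprB addrA subrK.
Qed.

Lemma ge0_integral_shift (c : R) (f : R -> \bar R) :
  measurable_fun setT f -> (forall x, 0 <= f x) ->
  \int[mu]_x f (x + c)%R = \int[mu]_x f x.
Proof.
move=> mf f0; transitivity (\int[mu]_x (f \o (fun x => x + c)%R) x) => //.
have mc : measurable_fun setT
    (fun x : measurableTypeR R => (x + c)%R : measurableTypeR R).
  exact: measurable_funD.
rewrite -[X in \int[mu]_(x in X) _](preimage_setT (fun x : R => x + c)%R).
rewrite -(ge0_integral_pushforward mc)//.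
apply: eq_measure_integral => // A mA _.
exact: lebesgue_measure_shift.
Qed.

(** On each line with fixed first coordinate the shear is a translation, so Tonelli's theorem
    reduces the claim to one dimension. *)
Lemma integral_shear2 (t : R) f : measurable_fun setT f -> (forall z, 0 <= f z) ->
  \int[mu2]_z f (z.1, z.2 + t * z.1)%R = \int[mu2]_z f z.
Proof.
move=> mf f0.
have mf' : measurable_fun setT (fun z : R * R => f (z.1, z.2 + t * z.1)%R).
  apply: measurableT_comp => //; apply: measurable_fun_pair => //=.
  by apply: measurable_funD => //; exact: measurable_funM.
rewrite fubini_tonelli1; [|exact: mf'|by move=> z; exact: f0].
rewrite fubini_tonelli1; [|exact: mf|exact: f0].
apply: eq_integral => x _.
apply: (@ge0_integral_shift (t * x)%R (fun y => f (x, y))) => //.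
exact: measurable_fun_pair2.
Qed.

Lemma integral_shear1 (t : R) f : measurable_fun setT f -> (forall z, 0 <= f z) ->
  \int[mu2]_z f (z.1 + t * z.2, z.2)%R = \int[mu2]_z f z.
Proof.
move=> mf f0.
have mf' : measurable_fun setT (fun z : R * R => f (z.1 + t * z.2, z.2)%R).
  apply: measurableT_comp => //; apply: measurable_fun_pair => //=.
  by apply: measurable_funD => //; exact: measurable_funM.
rewrite fubini_tonelli2; [|exact: mf'|by move=> z; exact: f0].
rewrite fubini_tonelli2; [|exact: mf|exact: f0].
apply: eq_integral => y _.
apply: (@ge0_integral_shift (t * y)%R (fun x => f (x, y))) => //.
exact: measurable_fun_pair1.
Qed.

Definition plane_rot (c s : R) (z : R * R) : R * R :=
  (c * z.1 + s * z.2, c * z.2 - s * z.1)%R.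

Lemma measurable_plane_rot c s : measurable_fun setT (plane_rot c s).
Proof.
apply: measurable_fun_pair => //=.
  by apply: measurable_funD; exact: measurable_funM.
by apply: measurable_funB; exact: measurable_funM.
Qed.

(* A rotation of angle [u] different from [pi] is a product of three shears:
   with [t = tan (u / 2)], [(1 t; 0 1) (1 0; - s 1) (1 t; 0 1) = (c s; - s c)]. *)
Lemma integral_rot (c s : R) f : (c ^+ 2 + s ^+ 2 = 1)%R -> (0 <= c)%R ->
  measurable_fun setT f -> (forall z, 0 <= f z) ->
  \int[mu2]_z f (plane_rot c s z) = \int[mu2]_z f z.
Proof.
move=> cs c0 mf f0.
(* The half-angle tangent is [s / (1 + c)]; [0 <= c] keeps the denominator nonzero. *)
have [t ct st] : exists2 t, c = (1 - t * s)%R & s = (t * (1 + c))%R.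
  have c1 : (1 + c != 0)%R by rewrite gt_eqF// ltr_pwDl.
  exists (s / (1 + c))%R; last by rewrite divfK.
  apply: (mulIf c1); rewrite mulrBl mul1r mulrAC divfK//.
  by rewrite mulrDr mulr1 -expr2 -[(s * s)%R]/(s ^+ 2)%R -cs; ring.
have mS1 (r : R) g : measurable_fun setT g -> measurable_fun setT
   (fun z : R * R => g (z.1 + r * z.2, z.2)%R : \bar R).
  move=> mg; apply: measurableT_comp => //; apply: measurable_fun_pair => //=.
  by apply: measurable_funD => //; exact: measurable_funM.
have mS2 (r : R) g : measurable_fun setT g -> measurable_fun setT
   (fun z : R * R => g (z.1, z.2 + r * z.1)%R : \bar R).
  move=> mg; apply: measurableT_comp => //; apply: measurable_fun_pair => //=.
  by apply: measurable_funD => //; exact: measurable_funM.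
pose g z := f (z.1 + t * z.2, z.2)%R.
pose k z := g (z.1, z.2 + (- s) * z.1)%R.
transitivity (\int[mu2]_z k (z.1 + t * z.2, z.2)%R).
  apply: eq_integral => z _; rewrite /k /g /plane_rot /=; congr (f (_, _)).
  - by rewrite {1}st ct; ring.
  - by rewrite ct; ring.
rewrite integral_shear1//; [|exact: (mS2 (- s)%R _ (mS1 t _ mf))|by move=> z; exact: f0].
rewrite integral_shear2//; [|exact: (mS1 t _ mf)|by move=> z; exact: f0].
by rewrite integral_shear1.
Qed.

(** [normal_pdf] agrees almost everywhere with the Radon-Nikodym derivative of [normal_prob], since
    both have the same integral over every measurable set. *)
Lemma integral_normal_prob (m s : R) (f : R -> \bar R) :
  measurable_fun setT f -> \int[normal_prob m s]_x `|f x| < +oo ->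
  \int[normal_prob m s]_x f x = \int[mu]_x (f x * (normal_pdf m s x)%:E).
Proof.
move=> mf fi.
rewrite -(Radon_Nikodym_change_of_variables (normal_prob_dominates m s))//=; last first.
  by apply/integrableP; split.
have mpdf : measurable_fun setT (fun x => (normal_pdf m s x)%:E).
  by apply/measurable_EFinP; exact: measurable_normal_pdf.
apply: ae_eq_integral => //.
- apply: emeasurable_funM => //; apply: (measurable_int mu).
  by apply: Radon_Nikodym_integrable; exact: normal_prob_dominates.
- exact: emeasurable_funM.
- apply: ae_eqe_mul2l => /=.
  rewrite Radon_NikodymE//=; first exact: normal_prob_dominates.
  move=> nmu; case: cid => /= h [h1 h2 h3].
  by apply: integral_ae_eq => //= E _ mE; rewrite -h3.
Qed.

Lemma normal_prob2E (s : R) (A : set (R * R)) : measurable A ->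
  (normal_prob 0 s \x normal_prob 0 s) A =
  \int[mu2]_z ((\1_A z * (normal_pdf 0 s z.1 * normal_pdf 0 s z.2))%:E).
Proof.
move=> mA.
pose f z : \bar R := (\1_A z * (normal_pdf 0 s z.1 * normal_pdf 0 s z.2))%:E.
have mpdf := @measurable_normal_pdf R 0 s.
have mf : measurable_fun setT f.
  apply/measurable_EFinP; apply: measurable_funM; first exact: measurable_indic.
  by apply: measurable_funM; exact: measurableT_comp.
have f0 z : 0 <= f z.
  by rewrite lee_fin mulr_ge0// mulr_ge0// normal_pdf_ge0.
rewrite fubini_tonelli1; [|exact: mf|exact: f0].
rewrite /product_measure1 integral_normal_prob; last 2 first.
- exact: measurable_fun_xsection.
- apply: (@le_lt_trans _ _ (\int[normal_prob 0 s]_x (cst 1 x))).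
    apply: ge0_le_integral => //.
    + exact/measurableT_comp/measurable_fun_xsection.
    + move=> x _; rewrite gee0_abs//; apply: probability_le1.
      exact: measurable_xsection.
  by rewrite integral_cst// mul1e; exact: (le_lt_trans (probability_le1 _ measurableT)) (ltry _).
apply: eq_integral => x _.
rewrite /fubini_F /= /normal_prob integral_mkcond.
rewrite -ge0_integralZr//=.
- apply: eq_integral => y _; rewrite /f patchE /= mem_xsection indicE.
  by case: ifPn => _; rewrite ?mul0e ?mul0r ?mul1r// -EFinM mulrC.
- apply/(measurable_restrictT _ _).1.
    exact: measurable_xsection.
  exact/measurable_funTS/measurable_EFinP.
- by move=> y _; rewrite patchE; case: ifP => // _; rewrite lee_fin normal_pdf_ge0.
- by rewrite lee_fin normal_pdf_ge0.
Qed.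

(** The planar density depends only on [x ^+ 2 + y ^+ 2], so what remains is the invariance of
    planar Lebesgue measure. *)
Lemma normal_prob2_rot (sigma c s : R) (A : set (R * R)) :
  (sigma != 0)%R -> (c ^+ 2 + s ^+ 2 = 1)%R -> (0 <= c)%R -> measurable A ->
  (normal_prob 0 sigma \x normal_prob 0 sigma) (plane_rot c s @^-1` A) =
  (normal_prob 0 sigma \x normal_prob 0 sigma) A.
Proof.
move=> s0 cs c0 mA.
have mrA : measurable (plane_rot c s @^-1` A).
  by rewrite -[X in measurable X]setTI; exact: measurable_plane_rot.
rewrite !normal_prob2E//.
pose f z : \bar R := (\1_A z * (normal_pdf 0 sigma z.1 * normal_pdf 0 sigma z.2))%:E.
have mpdf := @measurable_normal_pdf R 0 sigma.
rewrite -[RHS](@integral_rot c s f); last 4 first.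
- exact: cs.
- exact: c0.
- apply/measurable_EFinP; apply: measurable_funM; first exact: measurable_indic.
  by apply: measurable_funM; exact: measurableT_comp.
- by move=> z; rewrite lee_fin mulr_ge0// mulr_ge0// normal_pdf_ge0.
apply: eq_integral => -[x y] _; rewrite /f /=; congr (_ * _)%:E => /=.
rewrite normal_pdfE//= mulrACA [in RHS]mulrACA; congr (_ * _)%R.
rewrite /normal_fun -!expRD; congr expR.
rewrite !subr0 -!mulrDl; congr (_ / _)%R.
transitivity (- ((c ^+ 2 + s ^+ 2) * (x ^+ 2 + y ^+ 2)))%R; last by ring.
by rewrite cs; ring.
Qed.

End gaussian_plane.

(** * Borel structure and Euclidean norm on column vectors *)

Section vectors.
Context (R : realType) (d : nat).
Implicit Types v w x : 'cV[R]_d.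

Lemma measurable_coord (j : 'I_d) :
  measurable_fun setT (fun v : vecm R d => (v : 'cV[R]_d) j ord0).
Proof.
move=> _ B mB; rewrite setTI; apply: sub_sigma_algebra.
exists (fun k => if k == j then B else setT); split.
  by move=> k; case: ifP.
apply/seteqP; split => v /= vB; last by have := vB j; rewrite eqxx.
by move=> k; case: eqP => // ->.
Qed.

Lemma measurable_vecm d' (T : measurableType d') (f : T -> vecm R d) :
  (forall j, measurable_fun setT (fun t => (f t : 'cV[R]_d) j ord0)) ->
  measurable_fun setT f.
Proof.
move=> mf; apply: (@measurability _ _ _ _ setT f (boxes R d)) => //.
move=> _ [_ [B [mB ->]] <-]; rewrite setTI.
have -> : f @^-1` [set v : 'cV[R]_d | forall j, B j (v j ord0)] =
    \bigcap_(j in [set: 'I_d]) ((fun t => (f t : 'cV[R]_d) j ord0) @^-1` B j).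
  by apply/seteqP; split => t /= tB j; [move=> _|]; exact: tB.
apply: fin_bigcap_measurable => // j _.
by rewrite -[X in measurable X]setTI; exact: mf.
Qed.

Definition dot (v w : 'cV[R]_d) : R := \sum_(k < d) v k ord0 * w k ord0.

Lemma enormE v : enorm R d v = Num.sqrt (dot v v).
Proof. by rewrite /enorm /dot; under eq_bigr do rewrite expr2. Qed.

Lemma dotZl (r : R) v x : dot (r *: v) x = r * dot v x.
Proof. by rewrite /dot mulr_sumr; apply: eq_bigr => k _; rewrite mxE mulrA. Qed.

Lemma dotC v w : dot v w = dot w v.
Proof. by apply: eq_bigr => k _; rewrite mulrC. Qed.

Lemma mulmx_outer v x : (v *m v^T) *m x = dot v x *: v.
Proof.
apply/colP => j; rewrite -mulmxA mxE big_ord1 [RHS]mxE mulrC; congr (_ * _).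
by rewrite mxE; apply: eq_bigr => k _; rewrite mxE.
Qed.

Lemma enorm_ge0 v : 0 <= enorm R d v.
Proof. exact: sqrtr_ge0. Qed.

Lemma enormZ (r : R) v : enorm R d (r *: v) = `|r| * enorm R d v.
Proof.
by rewrite !enormE dotZl dotC dotZl mulrA -expr2 sqrtrM ?sqr_ge0// sqrtr_sqr.
Qed.

Lemma coord_le_enorm v k : `|v k ord0| <= enorm R d v.
Proof.
rewrite -sqrtr_sqr ler_wsqrtr// (bigD1 k)//= lerDl.
by apply: sumr_ge0 => i _; exact: sqr_ge0.
Qed.

Lemma enorm_le_sum v : enorm R d v <= \sum_(k < d) `|v k ord0|.
Proof.
have S0 (r : seq 'I_d) : 0 <= \sum_(k <- r) `|v k ord0| by exact: sumr_ge0.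
rewrite -[leRHS]ger0_norm ?sumr_ge0// -sqrtr_sqr ler_wsqrtr//.
elim: (index_enum _) => [|k r IH]; first by rewrite !big_nil expr0n.
rewrite !big_cons sqrrD -[v k ord0 ^+ 2]real_normK ?num_real//.
have := S0 r; have := normr_ge0 (v k ord0).
nra.
Qed.

Section measurability.
Context d' (T : measurableType d') (f g : T -> vecm R d) (r : T -> R).
Hypothesis mf : measurable_fun setT f.
Hypothesis mg : measurable_fun setT g.
Hypothesis mr : measurable_fun setT r.

Lemma measurable_dot : measurable_fun setT (fun t => dot (f t) (g t)).
Proof.
apply: measurable_sum => k; apply: measurable_funM.
  exact: (measurableT_comp (measurable_coord k) mf).
exact: (measurableT_comp (measurable_coord k) mg).
Qed.

Lemma measurable_addv :
  measurable_fun setT (fun t => ((f t : 'cV[R]_d) + g t)%R : vecm R d).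
Proof.
apply: measurable_vecm => j; under eq_fun do rewrite mxE.
apply: measurable_funD.
  exact: (measurableT_comp (measurable_coord j) mf).
exact: (measurableT_comp (measurable_coord j) mg).
Qed.

Lemma measurable_scalev :
  measurable_fun setT (fun t => (r t *: (f t : 'cV[R]_d)) : vecm R d).
Proof.
apply: measurable_vecm => j; under eq_fun do rewrite mxE.
apply: measurable_funM => //.
exact: (measurableT_comp (measurable_coord j) mf).
Qed.

End measurability.

Lemma measurable_enorm : measurable_fun setT (fun v : vecm R d => enorm R d v).
Proof.
under eq_fun do rewrite enormE.
apply: (measurableT_comp (f := @Num.sqrt R)); last exact: measurable_dot.
by apply: continuous_measurable_fun; exact: sqrt_continuous.
Qed.

End vectors.

(** * Givens rotations *)

Section givens.
Context (R : realType) (d : nat).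
Implicit Types v w x : 'cV[R]_d.

Definition givens (i j : 'I_d) (c s : R) (v : 'cV[R]_d) : 'cV[R]_d :=
  \col_k (if k == i then c * v i ord0 + s * v j ord0
          else if k == j then c * v j ord0 - s * v i ord0 else v k ord0).

Lemma givensD i j c s v w :
  givens i j c s (v + w) = givens i j c s v + givens i j c s w.
Proof.
by apply/colP => k; rewrite !mxE; case: ifP => _; [|case: ifP => _]; try ring.
Qed.

Lemma givensZ i j c s (r : R) v :
  givens i j c s (r *: v) = r *: givens i j c s v.
Proof.
by apply/colP => k; rewrite !mxE; case: ifP => _; [|case: ifP => _]; try ring.
Qed.

Lemma dot_givens i j c s v w : i != j -> c ^+ 2 + s ^+ 2 = 1 ->
  dot (givens i j c s v) (givens i j c s w) = dot v w.
Proof.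
move=> ij cs; have ji : j != i by rewrite eq_sym.
rewrite /dot (bigD1 i)//= (bigD1 j)//= [RHS](bigD1 i)//= [X in _ = _ + X](bigD1 j)//=.
rewrite !mxE eqxx (negbTE ji) eqxx !addrA; congr (_ + _).
  transitivity ((c ^+ 2 + s ^+ 2) * (v i ord0 * w i ord0 + v j ord0 * w j ord0)).
    by ring.
  by rewrite cs mul1r.
by apply: eq_bigr => k /andP[/negbTE ki /negbTE kj]; rewrite !mxE ki kj.
Qed.

Lemma enorm_givens i j c s v : i != j -> c ^+ 2 + s ^+ 2 = 1 ->
  enorm R d (givens i j c s v) = enorm R d v.
Proof. by move=> ij cs; rewrite !enormE dot_givens. Qed.

Lemma measurable_givens i j c s :
  measurable_fun setT (givens i j c s : vecm R d -> vecm R d).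
Proof.
have mc k := @measurable_coord R d k.
apply: measurable_vecm => k; under eq_fun do rewrite mxE.
have [_|_] := eqVneq k i.
  by apply: measurable_funD; apply: measurable_funM.
have [_|_] := eqVneq k j; last exact: mc.
by apply: measurable_funB; apply: measurable_funM.
Qed.

Lemma vecm_law_unique (m1 m2 : {measure set (vecm R d) -> \bar R}) :
  (m1 setT < +oo)%E ->
  (forall B : 'I_d -> set R, (forall j, measurable (B j)) ->
    m1 [set v : 'cV[R]_d | forall j, B j (v j ord0)] =
    m2 [set v : 'cV[R]_d | forall j, B j (v j ord0)]) ->
  forall A, measurable A -> m1 A = m2 A.
Proof.
move=> m1oo m12 A mA.
apply: (@measure_unique _ R (vecm R d) (boxes R d) (fun=> setT)) => //.
- move=> _ _ [B1 [mB1 ->]] [B2 [mB2 ->]].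
  exists (fun j => B1 j `&` B2 j); split; first by move=> j; exact: measurableI.
  apply/seteqP; split => v /=; first by move=> [v1 v2] j; split; [exact: v1|exact: v2].
  by move=> v12; split => j; case: (v12 j).
- by move=> _; exists (fun=> setT); split => //; apply/seteqP; split.
- by rewrite bigcup_const.
- by move=> _ [B [mB ->]]; exact: m12.
Qed.

End givens.

(* The coordinates of [z] are rotated into coordinate [i0] one after the other, the
   sign of the result being chosen so that the cosine is nonnegative. *)
Lemma givens_orbit (R : realType) (d : nat) (i0 : 'I_d) (s : R)
    (phi : 'cV[R]_d -> \bar R) :
  (forall i j c t z, i != j -> c ^+ 2 + t ^+ 2 = 1 -> 0 <= c ->
    phi (givens i j c t z) = phi z) ->
  (forall r z, phi (r *: z) = (`|r| `^ s)%:E * phi z)%E ->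
  forall z, (phi z = ((enorm R d z) `^ s)%:E * phi (delta_mx i0 ord0))%E.
Proof.
move=> phig phiZ.
(* Generalised to vectors vanishing off [i0] and the list [r]; each induction step clears the
   coordinate at the head of [r]. *)
suff H (r : seq 'I_d) : forall z : 'cV[R]_d,
    (forall k, k != i0 -> k \notin r -> z k ord0 = 0) ->
    (phi z = ((enorm R d z) `^ s)%:E * phi (delta_mx i0 ord0))%E.
  by move=> z; apply: (H (enum 'I_d)) => k _; rewrite mem_enum.
elim: r => [|j r IH] z zr.
  have -> : z = z i0 ord0 *: delta_mx i0 ord0.
    apply/colP => k; rewrite !mxE eqxx andbT.
    by have [->|/zr->//] := eqVneq k i0; rewrite ?mulr1 ?mulr0.
  rewrite phiZ enormZ; congr ((_ `^ _)%:E * _)%E.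
  rewrite -[LHS]mulr1; congr (_ * _).
  rewrite /enorm (bigD1 i0)//= big1 ?addr0; last first.
    by move=> k /negbTE ki; rewrite mxE ki expr0n.
  by rewrite mxE !eqxx expr1n sqrtr1.
have [ji0|ji0] := eqVneq j i0.
  by apply: IH => k ki kr; apply: zr => //; rewrite inE ji0 (negbTE ki).
have i0j : i0 != j by rewrite eq_sym.
pose q := Num.sqrt (z i0 ord0 ^+ 2 + z j ord0 ^+ 2).
have q2 : q ^+ 2 = z i0 ord0 ^+ 2 + z j ord0 ^+ 2.
  by rewrite sqr_sqrtr// addr_ge0// sqr_ge0.
have [q0|q0] := eqVneq q 0.
  have zj0 : z j ord0 = 0.
    move/eqP: q2; rewrite q0 expr0n/= eq_sym paddr_eq0 ?sqr_ge0//.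
    by rewrite !sqrf_eq0 => /andP[_ /eqP].
  apply: IH => k ki kr; have [->//|kj] := eqVneq k j.
  by apply: zr => //; rewrite inE negb_or kj.
have qgt0 : 0 < q by rewrite lt0r q0 sqrtr_ge0.
(* With the cosine and sine below, the rotated vector has [e * q] in coordinate [i0] and 0 in
   coordinate [j]. *)
pose e : R := if 0 <= z i0 ord0 then 1 else -1.
have ez : `|z i0 ord0| = e * z i0 ord0.
  rewrite /e; case: ifPn => z0; first by rewrite mul1r ger0_norm.
  by rewrite mulN1r ltr0_norm// ltNge.
have e2 : e ^+ 2 = 1 by rewrite /e; case: ifP; rewrite ?sqrrN expr1n.
pose c := `|z i0 ord0| / q.
pose t := e * z j ord0 / q.
have ct : c ^+ 2 + t ^+ 2 = 1.
  rewrite /c /t !exprMn e2 mul1r real_normK ?num_real// -mulrDl -q2 -exprMn.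
  by rewrite divff// expr1n.
have c0 : 0 <= c by rewrite divr_ge0// ltW.
rewrite -(phig _ _ _ _ z i0j ct c0) -(enorm_givens z i0j ct).
apply: IH => k ki kr; rewrite mxE (negbTE ki).
have [_|kj] := eqVneq k j; last by apply: zr => //; rewrite inE negb_or kj.
by rewrite /c /t ez; ring.
Qed.

(** * Rotation invariance of the Gaussian law on column vectors *)

Section gaussian_vector.
Context (R : realType) (d : nat) (dT : measure_display) (T : measurableType dT).
Variables (P : probability T R) (sigma : R) (X : T -> 'cV[R]_d).
Hypothesis sigma0 : sigma != 0.
Hypothesis mX : forall j, measurable_fun setT (fun w => X w j ord0).
Hypothesis indepX : mutual_indep dT T R P 'I_d
  (fun j => preimg_class dT _ T R (fun w => X w j ord0)).
Hypothesis normalX : forall (j : 'I_d) (B : set R), measurable B ->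
  P ((fun w => X w j ord0) @^-1` B) = normal_prob 0 sigma B.

(** It suffices to compare boxes. The coordinates other than [i] and [j] are untouched and form an
    event [E] whose probability factors out; the other factor is a planar Gaussian measure,
    invariant by [normal_prob2_rot]. *)
Lemma gaussian_givens i j c s (A : set (vecm R d)) :
  i != j -> c ^+ 2 + s ^+ 2 = 1 -> 0 <= c -> measurable A ->
  P ((fun w => givens i j c s (X w)) @^-1` A) = P (X @^-1` A).
Proof.
move=> ij cs c0.
have mXv : measurable_fun setT (X : T -> vecm R d) by exact: measurable_vecm.
have mGX : measurable_fun setT ((fun w => givens i j c s (X w)) : T -> vecm R d).
  exact: (measurableT_comp (@measurable_givens _ _ _ _ _ _)).
pose m1 : {measure set (vecm R d) -> \bar R} :=
  distribution P (mfun_Sub (mem_set mGX)).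
pose m2 : {measure set (vecm R d) -> \bar R} :=
  distribution P (mfun_Sub (mem_set mXv)).
move: A; apply: (@vecm_law_unique _ _ m1 m2).
  by rewrite (le_lt_trans (probability_le1 _ measurableT))// ltry.
move=> B mB.
pose J0 := [seq k <- enum 'I_d | (k != i) && (k != j)].
have mem_J0 k : (k \in J0) = (k != i) && (k != j).
  by rewrite mem_filter mem_enum andbT.
pose E := \big[setI/setT]_(k <- J0) ((fun w => X w k ord0) @^-1` B k).
have EP w : E w <-> forall k, k != i -> k != j -> B k (X w k ord0).
  rewrite /E -(@bigcap_seq _ _ J0); split.
    by move=> wB k ki kj; apply: (wB k); rewrite /= mem_J0 ki.
  by move=> wB k /=; rewrite mem_J0 => /andP[]; exact: wB.
have mE : measurable E.
  apply: bigsetI_measurable => k _.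
  by rewrite -[X in measurable X]setTI; exact: mX.
have indepE (A1 A2 : set R) : measurable A1 -> measurable A2 ->
    P (E `&` ((fun w => X w i ord0) @^-1` A1 `&` (fun w => X w j ord0) @^-1` A2)) =
    (P E * (normal_prob 0 sigma A1 * normal_prob 0 sigma A2))%E.
  move=> mA1 mA2.
  (* A single family of events, so that mutual independence can be used both on [i :: j :: J0] and
     on [J0] alone. *)
  pose F k := (fun w => X w k ord0) @^-1`
    (if k == i then A1 else if k == j then A2 else B k).
  have mF k : k \in i :: j :: J0 ->
      preimg_class dT _ T R (fun w => X w k ord0) (F k).
    by move=> _; exists (if k == i then A1 else if k == j then A2 else B k);
      first by case: ifP => // _; case: ifP.
  have EF : E = \big[setI/setT]_(k <- J0) F k.
    rewrite /E; apply: eq_big_seq => k; rewrite mem_J0 => /andP[/negbTE ki /negbTE kj].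
    by rewrite /F ki kj.
  have uJ : uniq (i :: j :: J0).
    rewrite /= inE negb_or ij !mem_J0 !eqxx/= andbF/=.
    by rewrite filter_uniq// enum_uniq.
  have ji : j == i = false by rewrite eq_sym; exact: negbTE.
  have := @indepX _ F uJ mF.
  rewrite !big_cons -EF.
  have := @indepX J0 F _ _; rewrite -EF => <-; last 2 first.
    by rewrite filter_uniq// enum_uniq.
    by move=> k kJ; apply: mF; rewrite !inE kJ !orbT.
  rewrite /F eqxx ji eqxx !normalX// => PJ.
  by rewrite muleC -muleA -PJ [in LHS]setIC -setIA.
pose N : {sigma_finite_measure set (measurableTypeR R) -> \bar R} := normal_prob 0 sigma.
have PC := @indep_pair_product R _ _ _ T (measurableTypeR R) (measurableTypeR R)
  P E _ _ N N mE (mX i) (mX j) indepE.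
have mBB : measurable (B i `*` B j : set (R * R)) by exact: measurableX.
have mrBB : measurable (plane_rot c s @^-1` (B i `*` B j)).
  by rewrite -[X in measurable X]setTI; exact: measurable_plane_rot.
transitivity (P (E `&` (fun w => (X w i ord0, X w j ord0)) @^-1`
    (plane_rot c s @^-1` (B i `*` B j)))).
  rewrite /m1 /distribution/= /pushforward; congr (P _).
  apply/seteqP; split => w /=.
    move=> wB; split; last split => /=.
    - by apply/EP => k /negbTE ki /negbTE kj; have := wB k; rewrite mxE ki kj.
    - by have := wB i; rewrite mxE eqxx.
    - by have := wB j; rewrite mxE eq_sym (negbTE ij) eqxx.
  move=> [/EP wE [/= wi wj]] k; rewrite mxE.
  by have [->//|ki] := eqVneq k i; have [->//|kj] := eqVneq k j; exact: wE.
rewrite PC// normal_prob2_rot// -PC//.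
rewrite /m2 /distribution/= /pushforward; congr (P _).
apply/seteqP; split => w /=.
  move=> [/EP wE [/= wi wj]] k.
  by have [->//|ki] := eqVneq k i; have [->//|kj] := eqVneq k j; exact: wE.
by move=> wB; split; [apply/EP => k _ _|split].
Qed.

End gaussian_vector.

(** * Independence of the past and the forthcoming samples *)

Section process.
Context (R : realType) (dT : measure_display) (T : measurableType dT).
Variables (P : probability T R) (d : nat).
Variables (a : nat -> T -> 'cV[R]_d) (y : nat -> T -> R).
Hypothesis ma : forall i j, measurable_fun setT (fun w => a i w j ord0).
Hypothesis my : forall i, measurable_fun setT (y i).
Local Notation V := (vecm R d).
Local Notation S := (V * R)%type.
Definition sample (l : nat) (w : T) : S := (a l w, y l w).

Lemma measurable_a l : measurable_fun setT (a l : T -> V).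
Proof. exact: measurable_vecm. Qed.

Lemma measurable_sample l : measurable_fun setT (sample l).
Proof. by apply: measurable_fun_pair => //; exact: measurable_a. Qed.

(** Says at once that [X] is independent of the samples of index at least [m] and, with [A = setT],
    that those samples are mutually independent. This is the invariant propagated along the
    recursion, [X] being the current state. *)
Definition future_indep d' (U : measurableType d') (m : nat) (X : T -> U) :=
  forall A, measurable A -> forall (J : seq nat) (B : nat -> set T), uniq J ->
    (forall l, l \in J -> (m <= l)%N) ->
    (forall l, l \in J -> preimg_class dT _ T S (sample l) (B l)) ->
    P (X @^-1` A `&` \big[setI/setT]_(l <- J) B l) =
    (P (X @^-1` A) * \prod_(l <- J) P (B l))%E.

Lemma future_indep_leq d' (U : measurableType d') m n (X : T -> U) :
  (m <= n)%N -> future_indep m X -> future_indep n X.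
Proof.
move=> mn iX A mA J B uJ nJ; apply: iX => // l lJ.
exact: leq_trans mn (nJ _ lJ).
Qed.

Lemma future_indep_comp d1 d2 (U : measurableType d1) (U' : measurableType d2)
    m (X : T -> U) (f : U -> U') :
  measurable_fun setT f -> future_indep m X -> future_indep m (f \o X).
Proof.
move=> mf iX A mA J B uJ nJ BJ.
rewrite comp_preimage; apply: iX => //.
by rewrite -[X in measurable X]setTI; exact: mf.
Qed.

Lemma future_indep_setI d' (U : measurableType d') m (X : T -> U) J B :
  future_indep m X -> uniq J -> (forall l, l \in J -> (m <= l)%N) ->
  (forall l, l \in J -> preimg_class dT _ T S (sample l) (B l)) ->
  P (\big[setI/setT]_(l <- J) B l) = (\prod_(l <- J) P (B l))%E.
Proof.
move=> iX uJ mJ BJ; have := iX setT measurableT J B uJ mJ BJ.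
by rewrite preimage_setT setTI probability_setT mul1e.
Qed.

Lemma future_indep_sample d' (U : measurableType d') m (X : T -> U) :
  future_indep m X -> forall A B, measurable A -> measurable B ->
  P (X @^-1` A `&` sample m @^-1` B) = (P (X @^-1` A) * P (sample m @^-1` B))%E.
Proof.
move=> iX A B mA mB.
have := iX A mA [:: m] (fun=> sample m @^-1` B) erefl.
rewrite !big_seq1; apply; first by move=> l; rewrite inE => /eqP ->.
by move=> l; rewrite inE => /eqP ->; exists B.
Qed.

(** On an event [E] described by samples after [m], the pair [(X, sample m)] keeps its product law
    up to the factor [P E], so every function of the pair is independent of [E]. *)
Lemma future_indep_step d1 d2 (U : measurableType d1) (U' : measurableType d2)
    m (X : T -> U) (f : U * S -> U') :
  measurable_fun setT X -> measurable_fun setT f -> future_indep m X ->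
  future_indep m.+1 (fun w => f (X w, sample m w)).
Proof.
move=> mX mf iX A mA J B uJ nJ BJ.
have iXm : future_indep m.+1 X by exact: future_indep_leq iX.
pose E := \big[setI/setT]_(l <- J) B l.
have mE : measurable E.
  rewrite /E big_seq; apply: bigsetI_measurable => l lJ.
  have [D mD ->] := BJ _ lJ.
  by rewrite -[X in measurable X]setTI; exact: measurable_sample.
have PE : P E = (\prod_(l <- J) P (B l))%E by exact: (future_indep_setI iXm).
pose DX : {sigma_finite_measure set U -> \bar R} :=
  distribution P (mfun_Sub (mem_set mX)).
pose DS : {sigma_finite_measure set S -> \bar R} :=
  distribution P (mfun_Sub (mem_set (measurable_sample m))).
have mC : measurable (f @^-1` A).
  by rewrite -[X in measurable X]setTI; exact: mf.
have PC := @indep_pair_product R _ _ _ T U S P _ _ _ DX DS _ mX (measurable_sample m).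
have := PC setT measurableT _ _ mC; rewrite setTI probability_setT mul1e => PTC.
have -> : (fun w => f (X w, sample m w)) @^-1` A =
  (fun w => (X w, sample m w)) @^-1` (f @^-1` A) by [].
rewrite PTC; last first.
  by move=> A1 A2 mA1 mA2; rewrite setTI mul1e future_indep_sample.
rewrite -PE -/E setIC PC//; first by rewrite muleC.
move=> A1 A2 mA1 mA2.
pose B' l := if l == m then sample m @^-1` A2 else B l.
have mJ : m \notin J by apply/negP => /nJ; rewrite ltnn.
have BB' l : l \in J -> B' l = B l.
  by move=> lJ; rewrite /B'; case: eqP lJ => // ->; rewrite (negbTE mJ).
have := iX A1 mA1 (m :: J) B'; rewrite /= mJ uJ !big_cons => /(_ isT).
rewrite (eq_big_seq _ BB') -/E.
rewrite (@eq_big_seq _ _ _ _ _ (fun l => P (B' l)) (fun l => P (B l))); last first.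
  by move=> l /BB' ->.
rewrite -PE [B' m]/B' eqxx => H.
rewrite muleC -muleA; apply: etrans (H _ _).
- by rewrite [in LHS]setIC setIA.
- by move=> l; rewrite inE => /predU1P[->//|/nJ/ltnW].
- move=> l; rewrite inE => /predU1P[->|lJ]; first by exists A2 => //; rewrite /B' eqxx.
  by rewrite BB'//; exact: BJ.
Qed.

Hypothesis ident : forall i (A : set S), measurable A ->
  P (sample i @^-1` A) = P (sample 0%N @^-1` A).

Lemma integral_sample l (f : S -> \bar R) :
  measurable_fun setT f -> (forall z, 0 <= f z)%E ->
  (\int[P]_w f (sample l w) = \int[P]_w f (sample 0%N w))%E.
Proof.
move=> mf f0.
transitivity (\int[pushforward P (sample l)]_z f z)%E.
  by rewrite (ge0_integral_pushforward (measurable_sample l)).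
transitivity (\int[pushforward P (sample 0%N)]_z f z)%E; last first.
  by rewrite (ge0_integral_pushforward (measurable_sample 0%N)).
apply: eq_measure_integral; try exact: measurable_sample.
by move=> ? ? A mA _; exact: ident.
Qed.

(** Identical distribution replaces sample [m] by sample 0, which makes the one-sample kernel
    independent of time. *)
Lemma future_integral d' (U : measurableType d') m (X : T -> U) (f : U * S -> \bar R) :
  measurable_fun setT X -> future_indep m X ->
  measurable_fun setT f -> (forall z, 0 <= f z)%E ->
  (\int[P]_w f (X w, sample m w) = \int[P]_w (\int[P]_w' f (X w, sample 0%N w')))%E.
Proof.
move=> mX iX mf f0.
rewrite (indep_integral mX (measurable_sample m)); last 3 first.
- exact: future_indep_sample.
- exact: mf.
- exact: f0.
apply: eq_integral => w _.
apply: (@integral_sample m (fun s => f (X w, s))) => //.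
exact: measurable_fun_pair2.
Qed.

(* With [c = 1] the recursion is [x |-> M x + q]; with [c = 0] it is its linear part
   [x |-> M x]. *)
Definition increment (c : R) (x : 'cV[R]_d) (u : 'cV[R]_d * R) : 'cV[R]_d :=
  (dot u.1 x - c * u.2) *: u.1.

Definition batch_sum (c : R) (m n : nat) (x : 'cV[R]_d) (w : T) : 'cV[R]_d :=
  \sum_(m <= l < m + n) increment c x (a l w, y l w).

(* One sample acts on a pair (state at the start of the batch, sum accumulated so
   far within the batch). *)
Definition kern (c : R) (f : V * V -> \bar R) (e : V * V) : \bar R :=
  (\int[P]_w f (e.1, (e.2 : 'cV[R]_d) + increment c e.1 (sample 0 w))%R)%E.

Definition kern_step (c : R) (z : (V * V) * S) : V * V :=
  (z.1.1, (z.1.2 : 'cV[R]_d) + increment c z.1.1 z.2).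

Lemma measurable_kern_step c : measurable_fun setT (kern_step c).
Proof.
have m11 : measurable_fun setT (fun z : (V * V) * S => z.1.1) by exact: measurableT_comp.
have m12 : measurable_fun setT (fun z : (V * V) * S => z.1.2) by exact: measurableT_comp.
have m21 : measurable_fun setT (fun z : (V * V) * S => z.2.1) by exact: measurableT_comp.
have m22 : measurable_fun setT (fun z : (V * V) * S => z.2.2) by exact: measurableT_comp.
apply: measurable_fun_pair; first exact: m11.
apply: measurable_addv; first exact: m12.
apply: measurable_scalev; first exact: m21.
apply: measurable_funB; first exact: measurable_dot.
by apply: measurable_funM.
Qed.

Lemma kern_ge0 c f : (forall z, 0 <= f z)%E -> forall e, (0 <= kern c f e)%E.
Proof. by move=> f0 e; exact: integral_ge0. Qed.

Lemma measurable_kern c f : measurable_fun setT f -> (forall z, 0 <= f z)%E ->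
  measurable_fun setT (kern c f).
Proof.
move=> mf f0.
pose g (z : (V * V) * T) : \bar R := f (kern_step c (z.1, sample 0 z.2)).
have mg : measurable_fun setT g.
  apply: (measurableT_comp mf); apply: (measurableT_comp (measurable_kern_step c)).
  apply: measurable_fun_pair => //.
  exact: (measurableT_comp (measurable_sample 0)).
by apply: (@measurable_fun_fubini_tonelli_F _ _ _ _ _ P g mg) => z; exact: f0.
Qed.

Lemma iter_kern_ge0 c n f : (forall z, 0 <= f z)%E ->
  forall e, (0 <= iter n (kern c) f e)%E.
Proof. by move=> f0; elim: n => [//|n IH] /=; exact: kern_ge0. Qed.

Lemma measurable_iter_kern c n f : measurable_fun setT f -> (forall z, 0 <= f z)%E ->
  measurable_fun setT (iter n (kern c) f).
Proof.
move=> mf f0; elim: n => [//|n IH] /=; apply: measurable_kern => //.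
exact: iter_kern_ge0.
Qed.

Lemma batch_sumS c m n x w :
  batch_sum c m n.+1 x w = batch_sum c m n x w + increment c x (sample (m + n) w).
Proof. by rewrite /batch_sum addnS big_nat_recr//= leq_addr. Qed.

Lemma batch_sum0 c m x w : batch_sum c m 0 x w = 0.
Proof. by rewrite /batch_sum addn0 big_geq. Qed.

(** * Integrating out a batch sample by sample *)

Section batch.
Variables (m : nat) (X : T -> V).
Hypothesis mX : measurable_fun setT X.
Hypothesis iX : future_indep m X.

Lemma batch_indep c n :
  measurable_fun setT (fun w => (X w, batch_sum c m n (X w) w) : V * V) /\
  future_indep (m + n) (fun w => (X w, batch_sum c m n (X w) w) : V * V).
Proof.
elim: n => [|n [mIH iIH]].
  rewrite addn0; have mX0 : measurable_fun setT (fun v : V => (v, 0) : V * V).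
    exact: measurable_fun_pair.
  under eq_fun do rewrite batch_sum0.
  by split; [exact: (measurableT_comp mX0)|exact: (future_indep_comp mX0 iX)].
have E : (fun w => (X w, batch_sum c m n.+1 (X w) w) : V * V) =
    (fun w => kern_step c ((X w, batch_sum c m n (X w) w) : V * V, sample (m + n) w)).
  by apply/funext => w; rewrite batch_sumS.
rewrite E addnS; split; last first.
  apply: (future_indep_step mIH) => //; exact: measurable_kern_step.
apply: (measurableT_comp (measurable_kern_step c)).
apply: measurable_fun_pair => //; exact: measurable_sample.
Qed.

(** The last sample of the batch is integrated out first, at the cost of replacing [f] by
    [kern c f]. *)
Lemma batch_integral c n (f : V * V -> \bar R) :
  measurable_fun setT f -> (forall z, 0 <= f z)%E ->
  (\int[P]_w f (X w, batch_sum c m n (X w) w) =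
   \int[P]_w iter n (kern c) f (X w, 0%R))%E.
Proof.
elim: n f => [|n IH] f mf f0; first by under eq_integral do rewrite batch_sum0.
have [mXn iXn] := batch_indep c n.
under eq_integral do rewrite batch_sumS.
have mg : measurable_fun setT (f \o kern_step c).
  exact: (measurableT_comp mf (measurable_kern_step c)).
apply: etrans (@future_integral _ _ _ _ _ mXn iXn mg (fun=> f0 _)) _.
rewrite iterSr -IH//.
- exact: measurable_kern.
- exact: kern_ge0.
Qed.

End batch.

Section fresh_batch.
Variables (m : nat) (X : T -> V).
Hypothesis mX : measurable_fun setT X.
Hypothesis iX : future_indep m X.
Hypothesis iC : forall v : V, future_indep 0 (fun _ : T => v).

(** For constant states, [iC] is mutual independence of the samples, and the iterated kernel becomes
    an expectation over the batch starting at sample 0. *)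
Lemma iter_kernE c n (f : V * V -> \bar R) v :
  measurable_fun setT f -> (forall z, 0 <= f z)%E ->
  (iter n (kern c) f (v, 0%R) = \int[P]_w f (v, batch_sum c 0 n v w))%E.
Proof.
move=> mf f0; rewrite (batch_integral (X := fun=> v) (m := 0%N))//.
by rewrite integral_cst//= probability_setT mule1.
Qed.

Lemma fresh_batch c n (f : V * V -> \bar R) :
  measurable_fun setT f -> (forall z, 0 <= f z)%E ->
  (\int[P]_w f (X w, batch_sum c m n (X w) w) =
   \int[P]_w (\int[P]_w' f (X w, batch_sum c 0 n (X w) w')))%E.
Proof.
move=> mf f0; rewrite batch_integral//; apply: eq_integral => w _.
by rewrite iter_kernE.
Qed.

End fresh_batch.

End process.

(** * Operator norm and growth rates *)

Section opnorm_bounds.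
Context (R : realType) (d : nat).
Implicit Types A : 'M[R]_d.

(** Each entry is at most the norm of its column, and the [d] rows give the factor [d]. A crude
    constant suffices: factors independent of [k] disappear in the [k]-th root. *)
Lemma enorm_mulmx A (v : 'cV[R]_d) :
  enorm R d (A *m v) <=
  enorm R d v * (d%:R * \sum_(j < d) enorm R d (A *m delta_mx j ord0)).
Proof.
apply: (le_trans (enorm_le_sum _)).
rewrite mulrCA mulr_natl -[X in _ *+ X](card_ord d) -sumr_const.
apply: ler_sum => i _; rewrite mxE (le_trans (ler_norm_sum _ _ _))// mulr_sumr.
apply: ler_sum => j _; rewrite normrM mulrC.
apply: ler_pM => //; first exact: coord_le_enorm.
have -> : A i j = (A *m delta_mx j ord0 : 'cV_d) i ord0 by rewrite -colE mxE.
exact: coord_le_enorm.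
Qed.

Let opnorm_ub A : ubound
  [set enorm R d (A *m v) | v in [set v : 'cV[R]_d | enorm R d v <= 1]]
  (d%:R * \sum_(j < d) enorm R d (A *m delta_mx j ord0)).
Proof.
move=> _ [v /= v1 <-]; apply: (le_trans (enorm_mulmx _ _)).
apply: ler_piMl => //; rewrite mulr_ge0// sumr_ge0// => j _; exact: enorm_ge0.
Qed.

Lemma enorm_le_opnorm A (v : 'cV[R]_d) :
  enorm R d v <= 1 -> enorm R d (A *m v) <= opnorm R d A.
Proof.
move=> v1; apply: ub_le_sup; last by exists v.
by eexists; exact: opnorm_ub.
Qed.

Lemma enorm0 : enorm R d 0 = 0.
Proof. by rewrite -(scale0r 0) enormZ normr0 mul0r. Qed.

Lemma opnorm_ge0 A : 0 <= opnorm R d A.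
Proof.
apply: le_trans (enorm_le_opnorm A (v := 0) _); first exact: enorm_ge0.
by rewrite enorm0.
Qed.

Lemma opnorm_le A :
  opnorm R d A <= d%:R * \sum_(j < d) enorm R d (A *m delta_mx j ord0).
Proof.
apply: ge_sup; last exact: opnorm_ub.
exists (enorm R d (A *m 0)); exists 0 => //=.
by rewrite enorm0.
Qed.

Lemma enorm_delta (i : 'I_d) : enorm R d (delta_mx i ord0) = 1.
Proof.
rewrite /enorm (bigD1 i)//= big1 ?addr0; last first.
  by move=> k /negbTE ki; rewrite mxE ki expr0n.
by rewrite mxE !eqxx expr1n sqrtr1.
Qed.

(** The sum is at most [d] times its largest term, which works for every [s >= 0] without convexity;
    [i0] ensures that a largest term exists. *)
Lemma powR_sum_le (i0 : 'I_d) (s c : R) (x : 'I_d -> R) : 0 <= s -> 0 <= c ->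
  (forall j, 0 <= x j) ->
  (c * \sum_(j < d) x j) `^ s <= (c * d%:R) `^ s * \sum_(j < d) x j `^ s.
Proof.
move=> s0 c0 x0.
have [j _ jmax] := @Order.TotalTheory.arg_maxP _ _ _ i0 predT x isT.
apply: (@le_trans _ _ ((c * d%:R) `^ s * x j `^ s)); last first.
  rewrite ler_wpM2l ?powR_ge0// (bigD1 j)//= lerDl sumr_ge0// => k _.
  exact: powR_ge0.
rewrite -powRM ?mulr_ge0// ge0_ler_powR ?nnegrE ?mulr_ge0 ?sumr_ge0//.
rewrite -mulrA ler_wpM2l// mulr_natl -[X in _ *+ X](card_ord d) -sumr_const.
by apply: ler_sum => k _; exact: jmax.
Qed.

End opnorm_bounds.

Lemma cvg_powR_harmonic (R : realType) (c : R) : 0 < c ->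
  c `^ (harmonic k) @[k --> \oo] --> (1 : R).
Proof.
move=> c0; rewrite -expR0 -(mul0r (ln c)).
under eq_fun do rewrite /powR (gt_eqF c0).
apply: (@cvg_comp _ _ _ (fun k => harmonic k * ln c) expR \oo
  (nbhs (0 * ln c))); last exact: continuous_expR.
by apply: cvgMl; exact: cvg_harmonic.
Qed.

(* The case [m = +oo] is excluded by the finiteness of the limit. *)
Lemma growth_rate_unique (R : realType) (u : nat -> \bar R) (m : \bar R) (c l : R) :
  0 < c -> (0 <= m)%E ->
  (forall k, m ^+ k <= u k)%E -> (forall k, u k <= c%:E * m ^+ k)%E ->
  (fun k => u k `^ (k%:R^-1))%E @ \oo --> l%:E -> m = l%:E.
Proof.
move=> c0 m0 mu um ul.
have u0 k : (0 <= u k)%E by rewrite (le_trans _ (mu k))// expe_ge0.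
(* The shift turns the exponent into [1 / (k + 1)] and avoids the inverse of 0. *)
have {}ul : (fun k => u k.+1 `^ (harmonic k))%E @ \oo --> l%:E.
  by move: ul; rewrite -cvg_shiftS.
have moo : (m < +oo)%E.
  have /fine_cvgP[[n _ un] _] := ul.
  have /= := un n (leqnn n); rewrite ge0_fin_numE ?poweR_ge0// => /lty_poweRy.
  rewrite gt_eqF ?harmonic_gt0// => /(_ isT) {}un.
  rewrite ltey; apply/eqP => moo.
  have := le_lt_trans (mu n.+1) un; rewrite moo expeS gt0_mulye ?ltxx//.
  exact: expe_gt0.
have mfin : m \is a fin_num by rewrite ge0_fin_numE.
have M0 : 0 <= fine m by rewrite fine_ge0.
move: mu um; rewrite -(fineK mfin); set M := fine m => mu um.
have powM k : ((M ^+ k.+1) `^ (harmonic k) = M)%R.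
  rewrite -powR_mulrn// -powRrM divff ?powRr1//.
have in0 (x : \bar R) : (0 <= x)%E -> x \in `[0%E, +oo%E].
  by move=> x0; rewrite in_itv/= x0 leey.
apply/eqP; rewrite eq_le; apply/andP; split.
  apply: (cvge_ge _ ul); apply: nearW => k.
  rewrite -{1}(powM k) -poweR_EFin gt0_ler_poweR ?harmonic_ge0 ?in0//.
    by rewrite lee_fin exprn_ge0.
  by rewrite EFin_expe.
have cM : (c `^ (harmonic k) * M)%:E @[k --> \oo] --> M%:E.
  apply: cvg_EFin; first exact: nearW.
  rewrite -[X in _ --> X]mul1r; apply: cvgMl; exact: cvg_powR_harmonic.
apply: (lee_cvg_to ul cM); apply: nearW => k.
rewrite -{1}(powM k) -powRM ?exprn_ge0 ?(ltW c0)// -poweR_EFin.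
rewrite gt0_ler_poweR ?harmonic_ge0 ?in0//.
  by rewrite lee_fin mulr_ge0 ?exprn_ge0// ltW.
by rewrite EFinM EFin_expe.
Qed.

(** * The recursion *)

Section sgd_recursion.
Context (R : realType) (dT : measure_display) (T : measurableType dT).
Variables (P : probability T R) (d b : nat) (eta : R).
Variables (a : nat -> T -> 'cV[R]_d) (y : nat -> T -> R).
Hypothesis ma : forall i j, measurable_fun setT (fun w => a i w j ord0).
Hypothesis my : forall i, measurable_fun setT (y i).
Local Notation V := (vecm R d).
Local Notation S := (V * R)%type.
Hypothesis ident : forall i (A : set S), measurable A ->
  P (sample a y i @^-1` A) = P (sample a y 0%N @^-1` A).
Hypothesis iC : forall v : V, future_indep P a y 0 (fun _ : T => v).

(* Batches are counted from 0 here: [batch_step c k] uses [Mk k.+1] and [qk k.+1]. *)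
Definition batch_step (c : R) (k : nat) (x : 'cV[R]_d) (w : T) : 'cV[R]_d :=
  x - (eta / b%:R) *: batch_sum a y c (b * k) b x w.

Fixpoint sgd (c : R) (X0 : T -> 'cV[R]_d) (k : nat) (w : T) : 'cV[R]_d :=
  if k is k'.+1 then batch_step c k' (sgd c X0 k' w) w else X0 w.

Lemma batch_stepE c k x w :
  batch_step c k x w =
  Mk R dT T d b eta a k.+1 w *m x + c *: qk R dT T d b eta a y k.+1 w.
Proof.
rewrite /batch_step /batch_sum /Mk /qk /Hk /= mulnS [(b + b * k)%N]addnC.
move: (eta / _) => r; rewrite mulmxBl mul1mx -scalemxAl mulmx_suml -addrA.
rewrite scalerA [c * _]mulrC -scalerA.
rewrite -!scalerN -scalerDr; congr (_ + _ *: _).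
rewrite scaler_sumr -!sumrN -big_split; apply: eq_bigr => l _ /=.
by rewrite /increment /= mulmx_outer scalerBl opprB addrC scalerA.
Qed.

Lemma xkE (x0 : T -> 'cV[R]_d) k w :
  xk R dT T d b eta a y x0 k w = sgd 1 x0 k w.
Proof. by elim: k => [//|k IH] /=; rewrite IH batch_stepE scale1r. Qed.

Lemma PikE z k w : Pik R dT T d b eta a k w *m z = sgd 0 (fun=> z) k w.
Proof.
elim: k => [|k IH] /=; first by rewrite mul1mx.
by rewrite -mulmxA IH batch_stepE scale0r addr0.
Qed.

Lemma measurable_batch_map :
  measurable_fun setT
    (fun e : V * V => ((e.1 : 'cV[R]_d) - (eta / b%:R) *: (e.2 : 'cV[R]_d) : V)).
Proof.
under eq_fun do rewrite -scaleNr.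
by apply: measurable_addv => //; exact: measurable_scalev.
Qed.

Lemma sgd_indep c (X0 : T -> V) k : measurable_fun setT X0 ->
  future_indep P a y 0 X0 ->
  measurable_fun setT (sgd c X0 k : T -> V) /\
  future_indep P a y (b * k) (sgd c X0 k : T -> V).
Proof.
move=> mX0 iX0; elim: k => [|k [mX iX]]; first by rewrite muln0.
have [mXb iXb] := batch_indep ma my mX iX c b.
rewrite mulnS addnC; split.
  exact: (measurableT_comp measurable_batch_map mXb).
exact: (future_indep_comp measurable_batch_map iXb).
Qed.

Lemma sgd_integral c (X0 : T -> V) k (f : V -> \bar R) :
  measurable_fun setT X0 -> future_indep P a y 0 X0 ->
  measurable_fun setT f -> (forall z, 0 <= f z)%E ->
  (\int[P]_w f (sgd c X0 k.+1 w) =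
   \int[P]_w (\int[P]_w' f (batch_step c 0 (sgd c X0 k w) w')))%E.
Proof.
move=> mX0 iX0 mf f0; have [mX iX] := sgd_indep c k mX0 iX0.
have mg := measurableT_comp mf measurable_batch_map.
rewrite /batch_step muln0.
exact: (fresh_batch ma my ident mX iX iC c b mg (fun=> f0 _)).
Qed.

Lemma batch_stepZ k (r : R) x w :
  batch_step 0 k (r *: x) w = r *: batch_step 0 k x w.
Proof. by rewrite !batch_stepE !scale0r !addr0 scalemxAr. Qed.

Lemma batch_stepB c k x1 x2 w :
  batch_step c k x1 w - batch_step c k x2 w = batch_step 0 k (x1 - x2) w.
Proof. by rewrite !batch_stepE scale0r addr0 mulmxBr opprD addrACA subrr addr0. Qed.

Lemma measurable_batch_step c :
  measurable_fun setT (fun z : V * T => batch_step c 0 z.1 z.2 : V).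
Proof.
rewrite /batch_step muln0.
have mG n : measurable_fun setT (fun z : V * T => batch_sum a y c 0 n z.1 z.2 : V).
  elim: n => [|n IH]; first by under eq_fun do rewrite batch_sum0; exact: measurable_cst.
  under eq_fun do rewrite batch_sumS.
  apply: measurable_addv => //; rewrite add0n.
  have m2 : measurable_fun setT (fun z : V * T => sample a y n z.2).
    exact: (measurableT_comp (measurable_sample ma my n)).
  have m21 : measurable_fun setT (fun z : V * T => (sample a y n z.2).1).
    exact: (measurableT_comp _ m2).
  have m22 : measurable_fun setT (fun z : V * T => (sample a y n z.2).2).
    exact: (measurableT_comp _ m2).
  apply: measurable_scalev; first exact: m21.
  apply: measurable_funB; first exact: measurable_dot.
  exact: measurable_funM.
have mp : measurable_fun setT (fun z : V * T => (z.1, batch_sum a y c 0 b z.1 z.2) : V * V).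
  by apply: measurable_fun_pair => //; exact: mG.
exact: (measurableT_comp measurable_batch_map mp).
Qed.

(** * Isotropy of the one-batch moment and contraction of the transport cost *)

Section isotropy.
Variable s : R.
Hypothesis s0 : 0 < s.
Definition npow (v : 'cV[R]_d) : \bar R := ((enorm R d v) `^ s)%:E.

Lemma npow_ge0 v : (0 <= npow v)%E.
Proof. by rewrite lee_fin powR_ge0. Qed.

Lemma measurable_npow : measurable_fun setT (npow : V -> \bar R).
Proof.
apply/measurable_EFinP; apply: (measurableT_comp (measurable_powR s)).
exact: measurable_enorm.
Qed.

Lemma npowZ r v : (npow (r *: v) = (`|r| `^ s)%:E * npow v)%E.
Proof. by rewrite /npow enormZ powRM ?enorm_ge0// EFinM. Qed.

(** This is [E ||M_1 z||^s]; its value at a unit vector is [m(s)]. *)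
Definition growth (z : 'cV[R]_d) : \bar R := (\int[P]_w npow (batch_step 0 0 z w))%E.

Lemma growth_ge0 z : (0 <= growth z)%E.
Proof. by apply: integral_ge0 => w _; exact: npow_ge0. Qed.

Lemma growthZ (r : R) z : (growth (r *: z) = (`|r| `^ s)%:E * growth z)%E.
Proof.
transitivity (\int[P]_w ((`|r| `^ s)%:E * npow (batch_step 0 0 z w)))%E.
  by apply: eq_integral => w _; rewrite batch_stepZ npowZ.
rewrite ge0_integralZl//.
- have mz : measurable_fun setT (fun w : T => (z, w) : V * T).
    exact: measurable_fun_pair.
  exact: (measurableT_comp measurable_npow
    (measurableT_comp (measurable_batch_step 0) mz)).
- by move=> w _; exact: npow_ge0.
Qed.

Hypothesis givens_a : forall i j c t (A : set V), i != j ->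
  c ^+ 2 + t ^+ 2 = 1 -> 0 <= c -> measurable A ->
  P ((fun w => givens i j c t (a 0 w)) @^-1` A) = P (a 0%N @^-1` A).

Lemma integral_givens i j c t (f : V -> \bar R) : i != j ->
  c ^+ 2 + t ^+ 2 = 1 -> 0 <= c -> measurable_fun setT f ->
  (forall v, 0 <= f v)%E ->
  (\int[P]_w f (givens i j c t (a 0 w)) = \int[P]_w f (a 0%N w))%E.
Proof.
move=> ij ct c0 mf f0.
have m0 := measurable_a ma 0.
have mg : measurable_fun setT (fun w => givens i j c t (a 0 w) : V).
  exact: (measurableT_comp (@measurable_givens _ _ i j c t) m0).
transitivity (\int[pushforward P (fun w => givens i j c t (a 0 w) : V)]_z f z)%E.
  by rewrite (ge0_integral_pushforward mg).
transitivity (\int[pushforward P (a 0%N : T -> V)]_z f z)%E; last first.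
  by rewrite (ge0_integral_pushforward m0).
apply: eq_measure_integral.
by move=> A mA _; exact: givens_a.
Qed.

(** An increment is built from a dot product and a scaling, so it commutes with a simultaneous
    rotation of state and sample. For the linear part the response is multiplied by 0, so the law of
    [a 0] alone decides. *)
Lemma kern_givens i j c t (f : V * V -> \bar R) : i != j ->
  c ^+ 2 + t ^+ 2 = 1 -> 0 <= c ->
  measurable_fun setT f -> (forall v, 0 <= f v)%E ->
  (forall e, f (givens i j c t e.1, givens i j c t e.2) = f e) ->
  forall e, kern P a y 0 f (givens i j c t e.1, givens i j c t e.2) = kern P a y 0 f e.
Proof.
move=> ij ct c0 mf f0 fg [x v]; rewrite /kern /=.
set g := givens i j c t.
pose k (u : V) : \bar R := f (g x, g v + increment 0 (g x) ((u : 'cV[R]_d), 0)).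
have mk : measurable_fun setT k.
  pose q u : (V * V) * S := ((g x, g v), (u, 0)).
  have mq : measurable_fun setT (q : V -> _).
    apply: measurable_fun_pair; first exact: measurable_cst.
    exact: measurable_fun_pair.
  exact: (measurableT_comp mf (measurableT_comp (measurable_kern_step 0) mq)).
transitivity (\int[P]_w k (a 0%N w))%E.
  by apply: eq_integral => w _; rewrite /k /increment /= !mul0r.
rewrite -(integral_givens ij ct c0 mk); last by move=> u; exact: f0.
apply: eq_integral => w _; rewrite /k /increment /= !mul0r !subr0.
by rewrite dot_givens// -givensZ -givensD -[RHS]fg.
Qed.

Lemma growth_givens i j c t z : i != j -> c ^+ 2 + t ^+ 2 = 1 -> 0 <= c ->
  growth (givens i j c t z) = growth z.
Proof.
move=> ij ct c0; set g := givens i j c t.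
pose f (e : V * V) : \bar R := npow ((e.1 : 'cV[R]_d) - (eta / b%:R) *: (e.2 : 'cV[R]_d)).
have mf : measurable_fun setT f.
  exact: (measurableT_comp measurable_npow measurable_batch_map).
have f0 e : (0 <= f e)%E by exact: npow_ge0.
have growthE x : growth x = iter b (kern P a y 0) f (x, 0).
  by rewrite (iter_kernE ma my ident iC 0 b x mf f0) /growth /batch_step muln0.
rewrite !growthE.
have fg n : forall e, iter n (kern P a y 0) f (g e.1, g e.2) = iter n (kern P a y 0) f e.
  elim: n => [|n IH] /=.
    by move=> e; rewrite /f /= /g -givensZ -scaleN1r -givensZ -givensD scaleN1r
      /npow enorm_givens.
  apply: kern_givens => //; first exact: measurable_iter_kern.
  exact: iter_kern_ge0.
have := fg b (z, 0); rewrite /= => <-; congr (iter _ _ _ (_, _)).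
by rewrite -[in RHS](scale0r (0 : 'cV[R]_d)) /g givensZ scale0r.
Qed.

Lemma growth_isotropic i0 z :
  growth z = (npow z * growth (delta_mx i0 ord0))%E.
Proof.
apply: (@givens_orbit R d i0 s growth) => [i j c t x ij ct c0|r x].
  exact: growth_givens.
exact: growthZ.
Qed.

Lemma moment_sgd i0 k z :
  (\int[P]_w npow (sgd 0 (fun=> z) k w) =
   growth (delta_mx i0 ord0) ^+ k * npow z)%E.
Proof.
have mz : measurable_fun setT ((fun=> z) : T -> V) by exact: measurable_cst.
elim: k => [|k IH].
  by rewrite expe0 mul1e /= integral_cst//= probability_setT mule1.
rewrite (sgd_integral 0 k mz (iC z) measurable_npow npow_ge0).
transitivity (\int[P]_w (npow (sgd 0 (fun=> z) k w) * growth (delta_mx i0 ord0)))%E.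
  by apply: eq_integral => w _; rewrite -growth_isotropic.
rewrite ge0_integralZr//.
- by rewrite IH expeS muleAC; congr (_ * _)%E; exact: muleC.
- exact: (measurableT_comp measurable_npow (sgd_indep 0 k mz (iC z)).1).
- by move=> w _; exact: npow_ge0.
- exact: growth_ge0.
Qed.

Lemma opnorm_growth i0 (l : R) :
  (fun k : nat =>
     ((\int[P]_w ((opnorm R d (Pik R dT T d b eta a k w)) `^ s)%:E) `^ (k%:R^-1))%E)
     @ \oo --> l%:E ->
  growth (delta_mx i0 ord0) = l%:E.
Proof.
have d0 : (0 < d)%N by case: (d) (i0) => [[]|].
have npow1 i : npow (delta_mx i ord0) = 1%E by rewrite /npow enorm_delta powR1.
have mom j k : (\int[P]_w npow (Pik R dT T d b eta a k w *m delta_mx j ord0) =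
    growth (delta_mx i0 ord0) ^+ k)%E.
  transitivity (\int[P]_w npow (sgd 0 (fun=> delta_mx j ord0) k w))%E.
    by apply: eq_integral => w _; rewrite PikE.
  by rewrite (moment_sgd i0) npow1 mule1.
(* Inside the power, one [d] comes from [opnorm_le] and one from [powR_sum_le]; the outer [d] counts
   the columns, each with moment [m(s)^k]. *)
pose C := (d%:R * d%:R) `^ s * d%:R : R.
apply: (@growth_rate_unique _ _ _ C).
- by rewrite mulr_gt0 ?powR_gt0 ?mulr_gt0 ?ltr0n.
- exact: growth_ge0.
- move=> k; rewrite -(mom i0 k); apply: ge0_le_integral_nomeas.
    by move=> w; exact: npow_ge0.
  move=> w; rewrite lee_fin ge0_ler_powR ?(ltW s0) ?nnegrE ?enorm_ge0//.
    exact: opnorm_ge0.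
  by rewrite enorm_le_opnorm// enorm_delta.
- move=> k.
  pose g (j : 'I_d) w := npow (Pik R dT T d b eta a k w *m delta_mx j ord0).
  have mg j : measurable_fun setT (g j).
    have -> : g j = npow \o (sgd 0 (fun=> delta_mx j ord0) k).
      by apply/funext => w; rewrite /g PikE.
    apply: (measurableT_comp measurable_npow).
    by apply: (sgd_indep 0 k _ (iC _)).1; exact: measurable_cst.
  have g0 j w : (0 <= g j w)%E by exact: npow_ge0.
  apply: (@le_trans _ _ (\int[P]_w (((d%:R * d%:R) `^ s)%:E * \sum_(j < d) g j w))%E).
    apply: ge0_le_integral_nomeas => w; first by rewrite lee_fin powR_ge0.
    rewrite /g sumEFin -EFinM lee_fin.
    apply: le_trans (powR_sum_le i0 (ltW s0) (ler0n _ d) (fun j => enorm_ge0 _)).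
    rewrite ge0_ler_powR ?(ltW s0) ?nnegrE//; last exact: opnorm_le.
    - exact: opnorm_ge0.
    - by rewrite mulr_ge0// sumr_ge0// => j _; exact: enorm_ge0.
  have mS : measurable_fun setT (fun w => (\sum_(j < d) g j w)%E).
    exact: emeasurable_sum.
  have S0 w : (0 <= \sum_(j < d) g j w)%E by exact: sume_ge0.
  rewrite ge0_integralZl//.
  rewrite ge0_integral_sum//; under eq_bigr do rewrite mom.
  rewrite sumr_const card_ord /C EFinM -muleA; apply: lee_wpmul2l.
    by rewrite lee_fin powR_ge0.
  by rewrite mule_natl.
Qed.

(** [Q'] is the law, under [Q \x P], of the two points moved by one common batch. The additive terms
    cancel in the difference, which evolves by the linear part, whence the exact factor. *)
Lemma coupling_step i0 (Q : probability (V * V)%type R) :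
  exists Q' : probability (V * V)%type R,
  (forall A : set V, measurable A ->
    Q' (A `*` setT) = (\int[Q]_z P ((batch_step 1 0 z.1 : T -> V) @^-1` A))%E /\
    Q' (setT `*` A) = (\int[Q]_z P ((batch_step 1 0 z.2 : T -> V) @^-1` A))%E) /\
  (\int[Q']_z npow ((z.1 : 'cV[R]_d) - z.2)%R =
   growth (delta_mx i0 ord0) * \int[Q]_z npow ((z.1 : 'cV[R]_d) - z.2)%R)%E.
Proof.
pose F (u : (V * V) * T) : V * V :=
  (batch_step 1 0 u.1.1 u.2, batch_step 1 0 u.1.2 u.2).
have mF : measurable_fun setT F.
  have mS := measurable_batch_step 1.
  apply: measurable_fun_pair.
    apply: (measurableT_comp mS (_ : measurable_fun setT (fun u : (V * V) * T => (u.1.1, u.2)))).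
    by apply: measurable_fun_pair => //; exact: measurableT_comp.
  apply: (measurableT_comp mS (_ : measurable_fun setT (fun u : (V * V) * T => (u.1.2, u.2)))).
  by apply: measurable_fun_pair => //; exact: measurableT_comp.
pose Q' : probability (V * V)%type R := distribution (Q \x P)%E (mfun_Sub (mem_set mF)).
exists Q'; split.
  move=> A mA; split; rewrite /Q' /distribution /= /pushforward /product_measure1 /=;
    apply: eq_integral => z _ /=; congr (P _); apply/seteqP; split => w /=;
    rewrite /xsection /= ?inE /F /=; by [move=> []|].
have mD : measurable_fun setT (fun z : V * V => npow ((z.1 : 'cV[R]_d) - z.2)).
  apply: (measurableT_comp measurable_npow).
  under eq_fun do rewrite -scaleN1r.
  by apply: measurable_addv => //; exact: measurable_scalev.
have D0 (z : V * V) : (0 <= npow ((z.1 : 'cV[R]_d) - z.2)%R)%E by exact: npow_ge0.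
transitivity (\int[Q \x P]_u npow ((F u).1 - (F u).2 : 'cV[R]_d)%R)%E.
  by rewrite (ge0_integral_pushforward mF).
rewrite fubini_tonelli1; last 2 first.
- exact: (measurableT_comp mD mF).
- by move=> u; exact: D0.
transitivity (\int[Q]_z (npow ((z.1 : 'cV[R]_d) - z.2)%R * growth (delta_mx i0 ord0)))%E.
  apply: eq_integral => z _; rewrite -growth_isotropic /growth /fubini_F /=.
  by apply: eq_integral => w _; rewrite batch_stepB.
rewrite ge0_integralZr//; first by rewrite muleC.
exact: growth_ge0.
Qed.

Lemma law_step (X0 : T -> V) k (A : set V) : measurable_fun setT X0 ->
  future_indep P a y 0 X0 -> measurable A ->
  P ((sgd 1 X0 k.+1 : T -> V) @^-1` A) =
  (\int[P]_w P ((batch_step 1 0 (sgd 1 X0 k w) : T -> V) @^-1` A))%E.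
Proof.
move=> mX0 iX0 mA.
have indicE (g : T -> V) : measurable_fun setT g ->
    (\int[P]_w (\1_A (g w) : R)%:E = P (g @^-1` A))%E.
  move=> mg; rewrite -[g @^-1` A]setIT -integral_indic//.
  by rewrite -[X in measurable X]setTI; exact: mg.
rewrite -indicE; last exact: (sgd_indep 1 k.+1 mX0 iX0).1.
rewrite (sgd_integral 1 k mX0 iX0 (f := fun v => (\1_A v)%:E)); last 2 first.
- by apply/measurable_EFinP; exact: measurable_indic.
- by move=> v; rewrite lee_fin.
apply: eq_integral => w _; rewrite indicE//.
have mp : measurable_fun setT (fun w' : T => (sgd 1 X0 k w, w') : V * T).
  exact: measurable_fun_pair.
exact: (measurableT_comp (measurable_batch_step 1) mp).
Qed.

Lemma measurable_step_prob (A : set V) : measurable A ->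
  measurable_fun setT (fun z : V => P ((batch_step 1 0 z : T -> V) @^-1` A)).
Proof.
move=> mA; have mB : measurable ((fun u : V * T => batch_step 1 0 u.1 u.2 : V) @^-1` A).
  by rewrite -[X in measurable X]setTI; exact: measurable_batch_step.
have := measurable_fun_xsection P mB; congr measurable_fun.
apply/funext => z /=; congr (P _).
by apply/seteqP; split => w /=; rewrite /xsection /= inE.
Qed.

(** The coupling given by [coupling_step] has the right first marginal by [law_step] and the right
    second one by stationarity of [nu]. Positivity of [l] lets the factor pass inside the
    infimum. *)
Lemma transport_cost_contraction i0 (X0 : T -> V) (nu : probability V R) k (l : R) :
  measurable_fun setT X0 -> future_indep P a y 0 X0 ->
  (forall A, measurable A ->
    nu A = \int[nu]_z P ((batch_step 1 0 z : T -> V) @^-1` A))%E ->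
  0 < l -> growth (delta_mx i0 ord0) = l%:E ->
  let cost n := ereal_inf [set \int[Q]_z npow ((z.1 : 'cV[R]_d) - z.2)%R
    | Q in couplings R d (law R dT T P d (sgd 1 X0 n)) nu]%E in
  (cost k.+1 <= l%:E * cost k)%E.
Proof.
move=> mX0 iX0 nuE l0 gl /=.
rewrite -ereal_inf_pZl//; apply: le_ereal_inf_tmp => _ [_ [Q Qc <-] <-].
apply: ge_ereal_inf; have [Q' [Q'E Q'cost]] := coupling_step i0 Q.
exists (\int[Q']_z npow ((z.1 : 'cV[R]_d) - z.2)%R)%E; last by rewrite Q'cost gl.
exists Q' => // A mA; have [-> ->] := Q'E _ mA.
have mA' := measurable_step_prob mA.
have mfst : measurable_fun setT (fst : V * V -> V) by [].
have msnd : measurable_fun setT (snd : V * V -> V) by [].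
have mX := (sgd_indep 1 k mX0 iX0).1.
split.
  rewrite /law /pushforward law_step//.
  transitivity (\int[pushforward Q fst]_z P ((batch_step 1 0 z : T -> V) @^-1` A))%E.
    by rewrite (ge0_integral_pushforward mfst).
  transitivity (\int[pushforward P (sgd 1 X0 k : T -> V)]_z
      P ((batch_step 1 0 z : T -> V) @^-1` A))%E; last first.
    by rewrite (ge0_integral_pushforward mX).
  apply: eq_measure_integral => B mB _.
  apply: etrans (proj1 (Qc B mB)); congr (Q _).
  by apply/seteqP; split => -[u v] /=; [|case].
rewrite [RHS]nuE//.
transitivity (\int[pushforward Q snd]_z P ((batch_step 1 0 z : T -> V) @^-1` A))%E.
  by rewrite (ge0_integral_pushforward msnd).
apply: eq_measure_integral => B mB _.
apply: etrans (proj2 (Qc B mB)); congr (Q _).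
by apply/seteqP; split => -[u v] /=; [|case].
Qed.

End isotropy.

End sgd_recursion.

(** * Moments of order below the tail-index *)

(* Weighted AM-GM: [x ^ p <= (1 - p / q) + (p / q) x ^ q]. *)
Lemma moment_le1 (R : realType) d (T : measurableType d) (P : probability T R)
    (X : T -> R) (p q : R) :
  measurable_fun setT X -> (forall w, 0 <= X w) -> 0 < p -> p < q ->
  (\int[P]_w (X w `^ q)%:E = 1 -> \int[P]_w (X w `^ p)%:E <= 1)%E.
Proof.
move=> mX X0 p0 pq Xq; have q0 := lt_trans p0 pq.
have mXr r : measurable_fun setT (fun w => (X w `^ r)%:E).
  by apply/measurable_EFinP; exact: (measurableT_comp (measurable_powR r)).
pose r := p / q.
have r0 : 0 <= r by rewrite divr_ge0// ltW.
have r1 : 0 < 1 - r by rewrite subr_gt0 ltr_pdivrMr// mul1r.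
have young w : X w `^ p <= (1 - r) + r * X w `^ q.
  have pqp : p * (q / p) = q by rewrite mulrC divfK ?gt_eqF.
  (* Young's inequality for the numbers [X w ^ p] and 1, with conjugate exponents [q / p] and
     [1 / (1 - r)]. *)
  have := @conjugate_powR R (X w `^ p) 1 (q / p) (1 - r)^-1 (powR_ge0 _ _) ler01.
  rewrite mulr1 powR1 -powRrM pqp !invrK invf_div mul1r => H.
  rewrite addrC [r * _]mulrC; apply: H.
  - by rewrite divr_gt0.
  - by rewrite invr_gt0.
  - by rewrite addrC subrK.
apply: (@le_trans _ _ (\int[P]_w ((1 - r)%:E + r%:E * (X w `^ q)%:E))%E).
  apply: ge0_le_integral_nomeas => w; first by rewrite lee_fin powR_ge0.
  by rewrite -EFinM -EFinD lee_fin.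
rewrite ge0_integralD//; last 3 first.
- by move=> w _; rewrite lee_fin ltW.
- by move=> w _; rewrite -EFinM lee_fin mulr_ge0// powR_ge0.
- exact: measurable_funeM.
rewrite ge0_integralZl//; last by move=> w _; rewrite lee_fin powR_ge0.
rewrite Xq integral_cst//= probability_setT !mule1 -EFinD subrK//.
Qed.

(** A vanishing moment forces [X = 0] almost surely, and this kills every other moment of nonzero
    order. *)
Lemma moment_eq0 (R : realType) d (T : measurableType d) (P : probability T R)
    (X : T -> R) (p q : R) :
  measurable_fun setT X -> p != 0 -> q != 0 ->
  (\int[P]_w (X w `^ p)%:E = 0 -> \int[P]_w (X w `^ q)%:E = 0)%E.
Proof.
move=> mX p0 q0.
have mXr r : measurable_fun setT (fun w => (X w `^ r)%:E).
  by apply/measurable_EFinP; exact: (measurableT_comp (measurable_powR r)).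
have absE r w : (`| (X w `^ r)%:E | = (X w `^ r)%:E)%E.
  by rewrite gee0_abs// lee_fin powR_ge0.
move=> Xp; have /(ae_eq_integral_abs P measurableT (mXr p)) Xp0 :
    (\int[P]_w `|(X w `^ p)%:E| = 0)%E by under eq_integral do rewrite absE.
under eq_integral do rewrite -absE.
apply/(ae_eq_integral_abs P measurableT (mXr q)).
apply: filterS Xp0 => w /(_ I) /= [] /eqP; rewrite powR_eq0 p0 andbT => /eqP -> _.
by rewrite powR0.
Qed.

Unset Implicit Arguments.

Theorem theorem6
  (R : realType) (dT : measure_display) (T : measurableType dT)
  (P : probability T R)
  (d b : nat) (hd : (0 < d)%N) (hb : (0 < b)%N)
  (eta : R) (heta : 0 < eta) (sigma : R) (hsigma : 0 < sigma)
  (a : nat -> T -> 'cV[R]_d) (y : nat -> T -> R) (x0 : T -> 'cV[R]_d)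
  (* the data and the initial point are random variables *)
  (ma : forall i (j : 'I_d), measurable_fun setT (fun w => a i w j ord0))
  (my : forall i, measurable_fun setT (y i))
  (mx0 : measurable_fun setT (x0 : T -> vecm R d))
  (* x0 and the samples (a_i, y_i), i in nat, are mutually independent *)
  (Hindep : mutual_indep dT T R P (option nat)
     (fun o => match o with
               | None => preimg_class dT _ T (vecm R d) x0
               | Some i => preimg_class dT _ T (vecm R d * R)%type
                             (fun w => (a i w, y i w) : vecm R d * R)
               end))
  (* the samples (a_i, y_i) are identically distributed *)
  (Hident : forall i (A : set (vecm R d * R)%type), measurable A ->
     P ((fun w => (a i w, y i w) : vecm R d * R) @^-1` A)
     = P ((fun w => (a 0%N w, y 0%N w) : vecm R d * R) @^-1` A))
  (* (A3): a_i ~ N(0, sigma^2 I_d) *)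
  (HA3 : forall i,
     mutual_indep dT T R P 'I_d
       (fun j => preimg_class dT _ T R (fun w => a i w j ord0)) /\
     forall (j : 'I_d) (B : set R), measurable B ->
       P ((fun w => a i w j ord0) @^-1` B) = normal_prob 0 sigma B)
  (* (A2): y_i has a continuous density supported on R, all moments finite *)
  (HA2 : forall i,
     (exists f : R -> R,
        continuous f /\ (forall x, 0 <= f x) /\
        closure [set x | f x != 0] = setT /\
        forall B : set R, measurable B ->
          P (y i @^-1` B) = (\int[lebesgue_measure]_(x in B) (f x)%:E)%E) /\
     forall n : nat, (\int[P]_w (`|y i w| ^+ n)%:E < +oo)%E)
  (* rho < 0, rho being the a.s. limit of (2k)^-1 log lambda_max(Pi_k^T Pi_k) *)
  (rho : R) (hrho : rho < 0)
  (Hrho : {ae P, forall w,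
     (fun k : nat => (2 * k%:R)^-1 *
        ln (lambda_max R d ((Pik R dT T d b eta a k w)^T *m Pik R dT T d b eta a k w)))
     @ \oo --> rho})
  (* h(s) = lim_k (E ||Pi_k||^s)^(1/k) *)
  (h : R -> R)
  (Hh : forall s, 0 < s ->
     (fun k : nat =>
        ((\int[P]_w ((opnorm R d (Pik R dT T d b eta a k w)) `^ s)%:E) `^ (k%:R^-1))%E)
     @ \oo --> (h s)%:E)
  (* tail-index: the unique alpha > 0 with h(alpha) = 1, and alpha > 1 *)
  (alpha : R) (halpha0 : 0 < alpha) (halpha : h alpha = 1)
  (halpha_uniq : forall s, 0 < s -> h s = 1 -> s = alpha)
  (halpha1 : 1 < alpha)
  (* nu_infty: the stationary distribution of the recursion *)
  (nuinf : probability (vecm R d) R)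
  (Hstat : forall A : set (vecm R d), measurable A ->
     nuinf A = (\int[nuinf]_z
                  P (((fun w => (Mk R dT T d b eta a 1 w *m z + qk R dT T d b eta a y 1 w)%R)
                       : T -> vecm R d) @^-1` A))%E)
  (p : R) (hp1 : 1 <= p) (hpalpha : p < alpha)
  (* nu_0 has finite p-th moment *)
  (Hmom : (\int[P]_w ((enorm R d (x0 w)) `^ p)%:E < +oo)%E) :
  0 < (h p) `^ p^-1 < 1 /\
  forall k : nat,
    (Wass R d p (law R dT T P d (xk R dT T d b eta a y x0 k)) nuinf
     <= ((h p) `^ (k%:R / p))%:E * Wass R d p (law R dT T P d x0) nuinf)%E.
Proof.
have iX0 : @future_indep R dT T P d a y _ (vecm R d) 0 x0.
  move=> A mA J B uJ _ BJ.
  pose F o := if o is Some l then B l else x0 @^-1` A.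
  have := Hindep (None :: map Some J) F; rewrite !big_cons !big_map; apply.
    rewrite /= map_inj_uniq ?uJ ?andbT; last by move=> u v [].
    by apply/mapP => -[].
  move=> [l|]; rewrite inE /=; last by move=> _; exists A.
  by rewrite mem_map; [exact: BJ|move=> u v []].
have iC (v : vecm R d) : @future_indep R dT T P d a y _ (vecm R d) 0 (fun=> v).
  exact: (future_indep_comp (measurable_cst v) iX0).
have mX0 : measurable_fun setT (x0 : T -> vecm R d) by exact: mx0.
pose i0 := Ordinal hd.
have givens_a i j c t (A : set (vecm R d)) : i != j -> c ^+ 2 + t ^+ 2 = 1 ->
    0 <= c -> measurable A ->
    P ((fun w => givens i j c t (a 0%N w)) @^-1` A) = P (a 0%N @^-1` A).
  have [ia na] := HA3 0%N.
  apply: (@gaussian_givens R d dT T P sigma (a 0%N) _ (ma 0%N) ia na).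
  by rewrite gt_eqF.
have p0 : 0 < p by exact: lt_le_trans hp1.
have growthE s : 0 < s -> growth P b eta a y s (delta_mx i0 ord0) = (h s)%:E.
  by move=> s0; apply: (opnorm_growth ma my Hident iC s0 givens_a); exact: Hh.
(* A single random variable whose moment of each order [s > 0] is [h s]: comparing [h p] with
   [h alpha] becomes comparing two of its moments. *)
pose X w := enorm R d (batch_step b eta a y 0 0 (delta_mx i0 ord0) w).
have mX : measurable_fun setT X.
  have m1 : measurable_fun setT (fun w : T => (delta_mx i0 ord0, w) : vecm R d * T).
    exact: measurable_fun_pair.
  exact: (measurableT_comp (@measurable_enorm R d)
    (measurableT_comp (measurable_batch_step b eta ma my 0) m1)).
have XE s : 0 < s -> (\int[P]_w (X w `^ s)%:E = (h s)%:E)%E.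
  by move=> s0; rewrite -growthE.
have hp_le1 : h p <= 1.
  rewrite -lee_fin -XE//; apply: (moment_le1 mX _ p0 hpalpha).
    by move=> w; exact: enorm_ge0.
  by rewrite XE// halpha.
have hp_lt1 : h p < 1.
  rewrite lt_neqAle hp_le1 andbT; apply/eqP => /(halpha_uniq _ p0) pa.
  by move: hpalpha; rewrite pa ltxx.
have hp_gt0 : 0 < h p.
  rewrite lt0r -lee_fin -XE//; apply/andP; split; last first.
    by apply: integral_ge0 => w _; rewrite lee_fin powR_ge0.
  apply/eqP => hp0.
  have : (\int[P]_w (X w `^ alpha)%:E = 0)%E.
    apply: (@moment_eq0 _ _ _ P X p alpha mX); rewrite ?gt_eqF//.
    by rewrite XE// hp0.
  by rewrite XE// halpha => -[/eqP]; rewrite oner_eq0.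
split.
  rewrite powR_gt0//=.
  have : h p `^ p^-1 < 1 `^ p^-1 by rewrite gt0_ltr_powR ?invr_gt0 ?nnegrE// ltW.
  by rewrite powR1.
(* The [p]-th power of the Wasserstein distance, for which one step costs the plain factor [h p]. *)
pose cost n := ereal_inf [set (\int[Q]_z ((enorm R d (z.1 - z.2 : 'cV[R]_d)) `^ p)%:E)%E
  | Q in couplings R d (law R dT T P d (xk R dT T d b eta a y x0 n)) nuinf].
have nuE (A : set (vecm R d)) : measurable A -> (nuinf A =
    \int[nuinf]_z P ((batch_step b eta a y 1 0 z : T -> vecm R d) @^-1` A))%E.
  move=> mA; rewrite (Hstat _ mA); apply: eq_integral => z _.
  have -> : batch_step b eta a y 1 0 z =
      (fun w => Mk R dT T d b eta a 1 w *m z + qk R dT T d b eta a y 1 w) => //.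
  by apply/funext => w; rewrite batch_stepE scale1r.
have xkE' n : xk R dT T d b eta a y x0 n = sgd b eta a y 1 x0 n.
  by apply/funext => w; exact: xkE.
have costS n : (cost n.+1 <= (h p)%:E * cost n)%E.
  rewrite /cost !xkE'.
  exact: (transport_cost_contraction ma my Hident iC givens_a n mX0 iX0 nuE
    hp_gt0 (growthE _ p0)).
have cost0 n : (0 <= cost n)%E.
  apply: le_ereal_inf_tmp => _ [Q _ <-].
  by apply: integral_ge0 => z _; rewrite lee_fin powR_ge0.
have costE n : (cost n <= (h p ^+ n)%:E * cost 0%N)%E.
  elim: n => [|n IH]; first by rewrite expr0 mul1e.
  rewrite exprS EFinM -muleA; apply: (le_trans (costS n)).
  by apply: lee_wpmul2l => //; rewrite lee_fin ltW.
move=> k; rewrite -[Wass R d p _ _]/((cost k) `^ p^-1)%E.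
rewrite -[X in (_ <= _ * X)%E]/((cost 0%N) `^ p^-1)%E.
have hk0 : 0 <= h p ^+ k by rewrite exprn_ge0// ltW.
rewrite powRrM powR_mulrn ?(ltW hp_gt0)// -poweR_EFin -poweRM ?lee_fin//.
apply: gt0_ler_poweR; rewrite ?invr_ge0 ?(ltW p0) ?in_itv/= ?leey ?andbT//.
by rewrite mule_ge0.
Qed.
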